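(* Let $T(x,y)=(x+y,y)$. There exists a smoothly linearizable real analytic transformation $\varphi=T+O(2)$ (defined near the origin of $\mathbb R^2$) which is not embeddable, in any neighborhood of the origin, as the time-1 mapping of any real analytic vector field of the form $$\frac{dx}{dt}=y+f(x,y),\qquad \frac{dy}{dt}=g(x,y),$$ where $f,g$ are convergent real power series starting with terms of order at least two.
   Context: $O(2)$ denotes terms of order at least two in $(x,y)$. A real analytic transformation is a real analytic local diffeomorphism near the origin of $\mathbb R^2$ fixing the origin. The transformation $\varphi=T+O(2)$ is smoothly linearizable if there is a $C^\infty$ local diffeomorphism $\psi$ fixing the origin with $\psi\circ\varphi\circ\psi^{-1}=T$ near the origin. The time-1 mapping of a vector field is $\varphi_1$, where $\varphi_t$ is the local flow of the vector field. *)

(* Defs.v *)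
From HB Require Import structures.
From mathcomp Require Import all_boot all_order all_algebra.
From mathcomp Require Import all_classical all_reals all_analysis.

Set Implicit Arguments.
Unset Strict Implicit.
Unset Printing Implicit Defensive.

Import Order.TTheory GRing.Theory Num.Theory.
Import numFieldNormedType.Exports.

Local Open Scope classical_set_scope.
Local Open Scope ring_scope.

Section Defs.
Context {R : realType}.

(* Germs at the origin of R^2 are represented by total functions, of which only
   the restriction to a neighborhood of the origin matters. The norm of R * R is
   the sup norm, so `|p| < r describes a square centered at the origin. *)

Definition shear (p : R * R) : R * R := (p.1 + p.2, p.2).

Definition is_psum (a : nat -> nat -> R) (r : R) (f : R * R -> R) : Prop :=
  forall p : R * R, `|p| < r ->
    cvgn (fun n => \sum_(i < n) \sum_(j < n) `|a i j * p.1 ^+ i * p.2 ^+ j|) /\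
    (fun n => \sum_(i < n) \sum_(j < n) a i j * p.1 ^+ i * p.2 ^+ j) @ \oo --> f p.

Definition order_ge2 (a : nat -> nat -> R) : Prop :=
  forall i j : nat, (i + j < 2)%N -> a i j = 0.

Definition analytic_near0 (f : R * R -> R) : Prop :=
  exists (a : nat -> nat -> R) (r : R), 0 < r /\ is_psum a r f.

Definition analytic_O2 (f : R * R -> R) : Prop :=
  exists (a : nat -> nat -> R) (r : R),
    [/\ order_ge2 a, 0 < r & is_psum a r f].

(* On an open set U: all partial derivatives of order at most k exist and are
   continuous. *)
Fixpoint Ck_on (k : nat) (U : set (R * R)) (f : R * R -> R) : Prop :=
  (forall p, U p -> {for p, continuous f}) /\
  (if k is k'.+1 then
     forall v : R * R, v = (1, 0) \/ v = (0, 1) ->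
       (forall p, U p -> derivable f p v) /\ Ck_on k' U ('D_v f)
   else True).

Definition smooth_near0 (f : R * R -> R) : Prop :=
  exists U : set (R * R), [/\ open U, U 0 & forall k, Ck_on k U f].

Definition local_inverse (phi theta : R * R -> R * R) : Prop :=
  (\forall p \near (0 : R * R), theta (phi p) = p) /\
  (\forall p \near (0 : R * R), phi (theta p) = p).

Definition componentwise (C : (R * R -> R) -> Prop) (phi : R * R -> R * R) :=
  C (fun p => (phi p).1) /\ C (fun p => (phi p).2).

(* phi is a local diffeomorphism of class C fixing the origin, with inverse
   germ theta. *)
Definition local_diffeo (C : (R * R -> R) -> Prop)
    (phi theta : R * R -> R * R) : Prop :=
  [/\ phi 0 = 0, componentwise C phi, componentwise C theta
    & local_inverse phi theta].

Definition analytic_transformation (phi : R * R -> R * R) : Prop :=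
  exists theta, local_diffeo analytic_near0 phi theta.

Definition tangent_to_shear (phi : R * R -> R * R) : Prop :=
  componentwise analytic_O2 (fun p => phi p - shear p).

Definition smoothly_linearizable (phi : R * R -> R * R) : Prop :=
  exists psi theta : R * R -> R * R,
    local_diffeo smooth_near0 psi theta /\
    \forall p \near (0 : R * R), psi (phi (theta p)) = shear p.

(* Graph of the local flow: the point q is reached at time t by the integral
   curve of X in V that starts at p. The curve is defined on an open interval
   containing 0 and t. For X locally Lipschitz on an open V, q is unique. *)
Definition flow_graph (X : R * R -> R * R) (V : set (R * R)) (t : R)
    (p q : R * R) : Prop :=
  exists (gamma : R -> R * R) (a b : R),
    [/\ a < 0 < b, a < t < b, gamma 0 = p, gamma t = q
      & forall s : R, a < s < b ->
          V (gamma s) /\ is_derive s 1 gamma (X (gamma s))].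

Definition embeddable (phi : R * R -> R * R) : Prop :=
  exists (c d : nat -> nat -> R) (f g : R * R -> R) (r : R),
    [/\ order_ge2 c /\ order_ge2 d, 0 < r, is_psum c r f, is_psum d r g
      & \forall p \near (0 : R * R),
          flow_graph (fun z => (z.2 + f z, g z)) [set z | `|z| < r] 1
            p (phi p)].

End Defs.

(* Main.v *)
Require Import Defs.
From mathcomp Require Import all_boot all_order all_algebra.
From mathcomp Require Import all_classical all_reals all_analysis.
From mathcomp Require Import measurable_realfun lebesgue_integral_under.
From mathcomp Require Import ring lra zify.

Set Implicit Arguments.
Unset Strict Implicit.
Unset Printing Implicit Defensive.

Import Order.TTheory GRing.Theory Num.Theory.
Import numFieldNormedType.Exports.

Local Open Scope classical_set_scope.
Local Open Scope ring_scope.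

(** Away from the fixed line y = 0 the slope t = y / (1 + x) is a good
    coordinate on the orbits of the shear T: T sends 1 / t to 1 / t + 1. For a
    function h of one variable, [slide h] : (x, y) |-> (x + h(t), y + t h(t))
    preserves t, so that slides compose by adding the functions h. Hence
    conjugating T by [slide h] gives the map
      (x, y) |-> (x + y + a(t), y + t / (1 + t) a(t)),
      a(t) = (1 + t) h(t) - h(t / (1 + t)),
    which is analytic as soon as a is, even if h is merely smooth. The proof
    uses the Laplace transform
      h(t) = 2 int_0^oo exp(- s) tanh(t s / 4) ds,
    called [lap 0]. It is smooth on the whole line by differentiation under the
    integral sign ([is_derive_lap]); a change of variables shows that
    a(t) = t^2 / (1 + t / 2) ([lap_functional_eq]), so the conjugated map [phi]
    is rational; and its Taylor series at 0 diverges ([lap_superexp]), because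
    its coefficients are those of 2 tanh(s / 4) multiplied by the moments k! of
    exp(- s), while the recursion given by the Riccati equation of tanh bounds
    the odd coefficients of tanh from below geometrically.

    The second component I = y + t h(t) of [slide h] is a first integral of
    [phi]. Let [phi] be the time-1 map of an analytic field (y + f, g). By
    Rolle's theorem the derivative of I along the field vanishes somewhere on
    each arc from p to [phi] p, and when p is close to the line y = 0 the whole
    arc is close to p ([flow_displacement]). Thus the derivative, up to the
    factor (1 + x)^2, is a function [defect] with zeros y > 0 arbitrarily
    close to every point (x0, 0). It has an asymptotic expansion in powers of y
    with continuous coefficients, so all these coefficients vanish
    ([zeros_kill_expansion]): the first one that did not would prevent zeros.
    At x = 0 this says that the Taylor series of (t h(t))' times a convergent
    power series y^2 + ... is a convergent power series. The coefficients of
    (t h(t))' would then grow at most geometrically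
    ([quotient_coef_growth]), which they do not. *)

(** * A Laplace transform with smooth extension through 0 *)

Section Laplace.
Context {R : realType}.
Implicit Types (s t u x y : R) (k n : nat).

(** This is tanh (u / 4). The scaling is chosen so that
    (1 - exp(- u)) th(u) = (1 - exp(- u / 2))^2 is a combination of exponentials,
    whose Laplace transform is rational. *)
Definition th u : R := (1 - expR (- (u / 2))) / (1 + expR (- (u / 2))).

Lemma th_den_neq0 u : 1 + expR (- (u / 2)) != 0.
Proof. by rewrite gt_eqF// addr_gt0// expR_gt0. Qed.

Lemma th0 : th 0 = 0.
Proof. by rewrite /th mul0r oppr0 expR0 subrr mul0r. Qed.

Lemma norm_th_le1 u : `|th u| <= 1.
Proof.
have e0 := expR_gt0 (- (u / 2)).
rewrite /th normrM normfV ler_pdivrMr ?normr_gt0 ?th_den_neq0//.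
rewrite mul1r (gtr0_norm (addr_gt0 ltr01 e0)) ler_norml.
by apply/andP; split; lra.
Qed.

Lemma is_derive_th u : is_derive u 1 th ((1 - th u ^+ 2) / 4).
Proof.
pose e v : R := expR (- (v / 2)).
have dl : is_derive u 1 (fun v : R => - (v / 2)) (- 2^-1).
  have -> : (fun v : R => - (v / 2)) = (fun v => (- 2^-1) *: v).
    by apply/funext => v; rewrite /GRing.scale /=; ring.
  by apply: is_derive_eq; rewrite /GRing.scale /=; ring.
have de : is_derive u 1 e (- 2^-1 * e u).
  by rewrite mulrC; exact: (@is_derive1_comp _ expR _ _ _ _ (is_derive_expR _) dl).
have dn : is_derive u 1 (fun v => 1 - e v) (e u / 2).
  by apply: (is_derive_eq (is_deriveB (is_derive_cst (1 : R) u 1) de)); ring.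
have dd : is_derive u 1 (fun v => 1 + e v) (- (e u / 2)).
  by apply: (is_derive_eq (is_deriveD (is_derive_cst (1 : R) u 1) de)); ring.
have dv := @is_deriveV _ (fun v => 1 + e v) _ _ _ (th_den_neq0 u) dd.
apply: (is_derive_eq (is_deriveM dn dv)); rewrite /th -/(e u) /GRing.scale /=.
have := th_den_neq0 u; rewrite -/(e u) => ne.
by field.
Qed.

(** The derivation of polynomials in [th] induced by [is_derive_th]. *)
Definition th_deriv (p : {poly R}) : {poly R} := p^`() * ((1 - 'X ^+ 2) * (4^-1)%:P).

(** As [th] satisfies a Riccati equation, its derivatives are polynomials in [th]
    itself: the k-th one is [th_der k] evaluated at [th]. *)
Fixpoint th_der k : {poly R} := if k is k'.+1 then th_deriv (th_der k') else 'X.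

(** The k-th derivative of exp(- s) th(t s) with respect to t. *)
Definition lap_fun k t s : R := expR (- s) * (s ^+ k * (th_der k).[th (t * s)]).

Lemma is_derive_lap_fun k t s :
  is_derive t 1 (fun t => lap_fun k t s) (lap_fun k.+1 t s).
Proof.
have dl : is_derive t 1 (fun t : R => t * s) s.
  have -> : (fun t : R => t * s) = (fun t => s *: t).
    by apply/funext => v; rewrite /GRing.scale /= mulrC.
  by apply: is_derive_eq; rewrite /GRing.scale /= mulr1.
have dth := @is_derive1_comp _ th _ _ _ _ (is_derive_th _) dl.
have dp := @is_derive1_comp _ (horner (th_der k)) _ _ _ _
  (is_derive_poly _ _) dth.
have -> : (fun t => lap_fun k t s) =
   (fun t => (expR (- s) * s ^+ k) *: (horner (th_der k) \o (th \o (fun t => t * s))) t).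
  by apply/funext => v; rewrite /lap_fun /GRing.scale /= mulrA.
apply: is_derive_eq; rewrite /GRing.scale /lap_fun /= /th_deriv !(hornerM, hornerD, hornerN, hornerX, hornerC) (exprS s).
by field.
Qed.

Lemma lap_fun0 t s : lap_fun 0 t s = expR (- s) * th (t * s).
Proof. by rewrite /lap_fun /= hornerX expr0 mul1r. Qed.

Lemma continuous_th : continuous th.
Proof.
move=> u; apply/differentiable_continuous/derivable1_diffP.
by have := is_derive_th u => -[].
Qed.

Lemma continuous_lap_fun k t : continuous (lap_fun k t).
Proof.
move=> s; rewrite /continuous_at /lap_fun; apply: cvgM.
  apply: (@continuous_comp _ _ _ -%R expR); last exact: continuous_expR.
  exact: continuousN.
apply: cvgM; first exact: exprn_continuous.
apply: (@continuous_comp _ _ _ (fun s => th (t * s))); last exact: continuous_horner.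
apply: (@continuous_comp _ _ _ (fun s => t * s)); last exact: continuous_th.
exact: mulrl_continuous.
Qed.

Lemma exprn_le_fact_expR k x : 0 <= x -> x ^+ k <= k`!%:R * expR x.
Proof.
move=> x0; case: k => [|k].
  by rewrite fact0 mul1r expr0 -expR0 ler_expR.
have h := expR_ge1Dxn k x0.
rewrite [leRHS]mulrC -ler_pdivrMr ?ltr0n ?fact_gt0//; apply: le_trans h.
by rewrite lerDr.
Qed.

Notation mu := (@lebesgue_measure R).

(** The bound is uniform in t because [th] takes its values in [-1, 1], and half
    of the exponential decay absorbs the power of s. *)
Lemma lap_fun_dominated k : exists G : R -> R,
  [/\ forall s, 0 <= G s, mu.-integrable `[0, +oo[ (EFin \o G) &
      forall t s, 0 <= s -> `|lap_fun k t s| <= G s].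
Proof.
have [C hC] := poly_disk_bound (th_der k) (1 : R).
have C0 : 0 <= C by apply: le_trans (hC 0 _); rewrite ?normr_ge0 ?normr0.
pose c := 2 ^+ k.+1 * k`!%:R * C.
have c0 : 0 <= c by rewrite !mulr_ge0// exprn_ge0.
have h0 : 0 <= 2^-1 :> R by rewrite invr_ge0.
have h1 : 0 < 2^-1 :> R by rewrite invr_gt0.
exists (fun s => c * exponential_pdf 2^-1 s); split.
- by move=> s; rewrite mulr_ge0// exponential_pdf_ge0.
- apply: (@integrableS _ _ _ _ setT) => //.
  under [X in integrable _ _ X]eq_fun do rewrite /= EFinM.
  by apply: integrableZl => //; exact: integrable_exponential_pdf.
- move=> t s s0.
  rewrite exponential_pdfE// /lap_fun normrM (ger0_norm (expR_ge0 _)) normrM.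
  (* One factor is the dominating function, the other one absorbs the power of s. *)
  have -> : expR (- s) = expR (- 2^-1 * s) * expR (- 2^-1 * s) :> R.
    by rewrite -expRD; congr expR; field.
  rewrite -[leRHS](_ : expR (- 2^-1 * s) * (2 ^+ k * k`!%:R * C) = _); last first.
    by rewrite /c exprS; field.
  rewrite -[leLHS]mulrA ler_pM2l ?expR_gt0// mulrA.
  apply: ler_pM; rewrite ?mulr_ge0 ?expR_ge0 ?normr_ge0//; last exact/hC/norm_th_le1.
  rewrite ger0_norm ?exprn_ge0//.
  have -> : s ^+ k = 2 ^+ k * (2^-1 * s) ^+ k.
    by rewrite -exprMn mulrA divff ?pnatr_eq0// mul1r.
  rewrite mulrCA ler_pM2l ?exprn_gt0//.
  rewrite mulNr expRN mulrC ler_pdivrMr ?expR_gt0//.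
  by apply: exprn_le_fact_expR; rewrite mulr_ge0.
Qed.

Lemma lap_fun_integrable k t :
  mu.-integrable `[0, +oo[ (EFin \o lap_fun k t).
Proof.
have [G [G0 iG GP]] := lap_fun_dominated k.
apply: le_integrable iG => //.
  apply/measurable_EFinP; apply: measurable_funTS.
  by apply: continuous_measurable_fun; exact: continuous_lap_fun.
move=> s /=; rewrite in_itv/= andbT => s0.
by rewrite lee_fin (ger0_norm (G0 s)); exact: GP.
Qed.

Definition lap k t : R := 2 * \int[mu]_(s in `[0, +oo[) lap_fun k t s.

Lemma is_derive_lap k t : is_derive t 1 (lap k) (lap k.+1 t).
Proof.
have [G [G0 iG GP]] := lap_fun_dominated k.+1.
have It : `]t - 1, t + 1[%classic t.
  by rewrite /= in_itv/=; apply/andP; split; lra.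
have dlap u s : partial1of2 (lap_fun k) u s = lap_fun k.+1 u s.
  rewrite partial1of2E.
  by have := is_derive_lap_fun k u s => dl; rewrite derive_val.
have der u s : derivable (lap_fun k ^~ s) u 1.
  by have := is_derive_lap_fun k u s => -[].
have D := @derivable_under_integral R _ _ mu (lap_fun k) `[0, +oo[ _
  t (t - 1) (t + 1) It (fun x _ => lap_fun_integrable k x)
  (fun x y _ _ => der x y) G G0 iG.
have V := @differentiation_under_integral R _ _ mu (lap_fun k) `[0, +oo[ _
  t (t - 1) (t + 1) It (fun x _ => lap_fun_integrable k x)
  (fun x y _ _ => der x y) G G0 iG.
have GB : forall x y, `]t - 1, t + 1[%classic x -> `[0, +oo[%classic y ->
    `|partial1of2 (lap_fun k) x y| <= G y.
  by move=> x y _; rewrite /= in_itv/= andbT => y0; rewrite dlap; exact: GP.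
have {}D := D ltac:(by []) GB.
have {}V := V ltac:(by []) GB.
have dI : is_derive t 1 (fun x => \int[mu]_(s in `[0, +oo[) lap_fun k x s)
     (\int[mu]_(s in `[0, +oo[) lap_fun k.+1 t s).
  apply: DeriveDef => //; rewrite -derive1E V.
  by apply: eq_Rintegral => s _; exact: dlap.
exact: (is_deriveZ 2 dI).
Qed.

End Laplace.

(** * Functional equation and derivatives at 0 *)

Section LaplaceFacts.
Context {R : realType}.
Implicit Types (s t u x y c : R) (k n : nat).
Notation mu := (@lebesgue_measure R).

Lemma expRMN_integrable c : 0 < c ->
  mu.-integrable `[0, +oo[ (EFin \o (fun s => expR (- (c * s)))).
Proof.
move=> c0.
have h : mu.-integrable setT (EFin \o exponential_pdf c).
  exact: integrable_exponential_pdf.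
have {}h : mu.-integrable `[0, +oo[ (EFin \o exponential_pdf c).
  exact: (@integrableS _ _ _ _ setT).
have {}h : mu.-integrable `[0, +oo[ (fun s => c^-1%:E * (EFin \o exponential_pdf c) s)%E.
  exact: integrableZl.
apply: eq_integrable h => // s; rewrite inE /= in_itv/= andbT => s0.
rewrite -EFinM exponential_pdfE//; congr EFin.
by rewrite mulNr mulrA mulVf ?gt_eqF// mul1r.
Qed.

Lemma Rintegral_expRMN c : 0 < c ->
  \int[mu]_(s in `[0, +oo[) expR (- (c * s)) = c^-1.
Proof.
move=> c0.
have : \int[mu]_(s in `[0, +oo[) (c * expR (- (c * s))) = 1.
  rewrite Rintegral_mkcond /Rintegral -[RHS]/(fine 1%:E).
  rewrite -(integral_exponential_pdf c0); congr fine.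
  apply: eq_integral => s _; congr EFin; rewrite /exponential_pdf.
  by congr patch; apply/funext => z; rewrite mulNr.
rewrite RintegralZl//; last exact: expRMN_integrable.
by move=> h; apply: (mulfI (lt0r_neq0 c0)); rewrite h divff// gt_eqF.
Qed.

Lemma Rintegral_scale c (G : R -> R) : 0 < c -> continuous G ->
  (forall s, 0 <= G s) ->
  \int[mu]_(s in `[0, +oo[) G s = \int[mu]_(s in `[0, +oo[) (c * G (c * s)).
Proof.
move=> c0 cG G0.
pose F s : R := c * s.
have dF : derive1 F = cst c.
  apply/funext => s; rewrite derive1E.
  have -> : F = (fun s => c *: s) by [].
  by rewrite derive_val /GRing.scale /= mulr1.
have cF : continuous F by move=> s; exact: mulrl_continuous.
have F0 : F 0 = 0 by rewrite /F mulr0.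
rewrite /Rintegral; congr fine.
rewrite -{1}F0 (@increasing_ge0_integration_by_substitutiony R F G 0)//.
- by apply: eq_integral => s _; rewrite dF /= /F mulrC.
- by move=> x y _ _ xy; rewrite /F ltr_pM2l.
- by rewrite dF => s _; exact: cst_continuous.
- by rewrite dF; exact: is_cvg_cst.
- by rewrite dF; exact: is_cvg_cst.
- split.
    move=> s _; apply: (@derivableZ _ _ _ id); exact: derivable_id.
  by apply: cvg_at_right_filter; exact: cF.
- by apply: gt0_cvgMry => //; exact: cvg_id.
- by apply: continuous_subspaceT.
Qed.

Lemma lap00 : lap 0 (0 : R) = 0.
Proof.
rewrite /lap.
rewrite (_ : \int[mu]_(s in _) _ = \int[mu]_(s in `[0, +oo[) 0); last first.
  by apply: eq_Rintegral => s _; rewrite lap_fun0 mul0r th0 mulr0.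
by rewrite Rintegral_cst// mul0r mulr0.
Qed.

(** The substitution s -> (1 + t) s expresses [lap 0 (t / (1 + t))] through
    th(t s), so that the left-hand side is twice (1 + t) times the integral of
    exp(- s) (1 - exp(- t s)) th(t s), a combination of three exponentials. *)
Lemma lap_functional_eq t : `|t| < 1 ->
  (1 + t) * lap 0 t - lap 0 (t / (1 + t)) = t ^+ 2 / (1 + t / 2).
Proof.
rewrite ltr_norml => /andP[t1 t2].
have p1 : 0 < 1 + t by lra.
have p2 : 0 < 1 + t / 2 by lra.
pose v := t / (1 + t).
(* Adding exp(- s) makes the integrand nonnegative, as the change of variables requires. *)
pose G s : R := expR (- (1 * s)) + lap_fun 0 v s.
have iE := @expRMN_integrable 1 ltr01.
have IE := @Rintegral_expRMN 1 ltr01.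
have GI : \int[mu]_(s in `[0, +oo[) G s =
    1 + \int[mu]_(s in `[0, +oo[) lap_fun 0 v s.
  rewrite /G RintegralD//; last exact: lap_fun_integrable.
  by rewrite IE invr1.
have cG : continuous G.
  move=> s; apply: cvgD; last exact: continuous_lap_fun.
  apply: (@continuous_comp _ _ _ (fun s => - (1 * s)) expR); last exact: continuous_expR.
  by apply: cvgN; exact: mulrl_continuous.
have G0 s : 0 <= G s.
  rewrite /G mul1r lap_fun0 -[X in X + _]mulr1 -mulrDr mulr_ge0 ?expR_ge0//.
  by have := norm_th_le1 (v * s); rewrite ler_norml => /andP[? ?]; lra.
(* This is (1 - exp(- t s)) th(t s) = (1 - exp(- t s / 2))^2, multiplied out. *)
have Gt s : (1 + t) * G ((1 + t) * s) = (1 + t) * lap_fun 0 t s +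
    ((1 + t) * (2 * expR (- ((1 + t / 2) * s))) - (1 + t) * expR (- (1 * s))).
  rewrite /G !lap_fun0 !mul1r.
  have -> : v * ((1 + t) * s) = t * s by rewrite /v; field; exact: lt0r_neq0.
  rewrite /th.
  have hN := th_den_neq0 (t * s).
  have -> : expR (- ((1 + t) * s)) =
      expR (- s) * expR (- (t * s / 2)) * expR (- (t * s / 2)).
    by rewrite -!expRD; congr expR; field.
  have -> : expR (- ((1 + t / 2) * s)) = expR (- s) * expR (- (t * s / 2)).
    by rewrite -!expRD; congr expR; field.
  by field.
have h : 1 + \int[mu]_(s in `[0, +oo[) lap_fun 0 v s =
   (1 + t) * (\int[mu]_(s in `[0, +oo[) lap_fun 0 t s) +
    ((1 + t) * (2 / (1 + t / 2)) - (1 + t)).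
  rewrite -GI (Rintegral_scale p1 cG G0); under eq_Rintegral do rewrite Gt.
  have i1 := @lap_fun_integrable R 0 t.
  have i2 := @expRMN_integrable _ p2.
  have z (c : R) f : mu.-integrable `[0, +oo[ (EFin \o f) ->
      mu.-integrable `[0, +oo[ (EFin \o (fun s => c * f s)).
    move=> hf.
    have : mu.-integrable `[0, +oo[ (fun s => c%:E * (EFin \o f) s)%E.
      exact: integrableZl.
    by apply: eq_integrable.
  have i3 := z (1 + t) _ (z 2 _ i2).
  have i4 := z (1 + t) _ iE.
  rewrite RintegralD//; last 2 first.
    exact: z.
    have := @integrableB _ _ _ mu `[0%R, +oo[ _ _ _ i3 i4.
    by apply => //.
  rewrite RintegralB// !RintegralZl//; last exact: z.
  by rewrite IE (Rintegral_expRMN p2) invr1 mulr1.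
have -> : lap 0 (t / (1 + t)) =
    2 * \int[mu]_(s in `[0, +oo[) lap_fun 0 v s by [].
rewrite /lap; move: h; set A := (\int[_]_(_ in _) _); set B := (\int[_]_(_ in _) _).
move=> h.
have -> : A = (1 + t) * B + ((1 + t) * (2 / (1 + t / 2)) - (1 + t)) - 1.
  by rewrite -h; ring.
by field; apply: lt0r_neq0; lra.
Qed.

Lemma moment_integrable k :
  mu.-integrable `[0, +oo[ (EFin \o (fun s => expR (- s) * s ^+ k)).
Proof.
have h1 : 0 < 2^-1 :> R by rewrite invr_gt0.
pose c : R := 2 ^+ k * k`!%:R.
have cE : c = 2 ^+ k * k`!%:R by [].
have c0 : 0 <= c by rewrite mulr_ge0// exprn_ge0.
clearbody c.
have i := expRMN_integrable h1.
have {}i : mu.-integrable `[0, +oo[ (fun s => c%:E * (EFin \o (fun s => expR (- (2^-1 * s)))) s)%E.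
  exact: integrableZl.
apply: le_integrable i => //.
  apply/measurable_EFinP; apply: measurable_funTS.
  apply: continuous_measurable_fun => s; rewrite /continuous_at.
  apply: cvgM; last exact: exprn_continuous.
  apply: (@continuous_comp _ _ _ -%R expR); last exact: continuous_expR.
  exact: continuousN.
move=> s /=; rewrite in_itv/= andbT => s0.
rewrite lee_fin !normrM (ger0_norm c0) !(ger0_norm (expR_ge0 _)) (ger0_norm (exprn_ge0 _ s0)).
have -> : expR (- s) = expR (- (2^-1 * s)) * expR (- (2^-1 * s)) :> R.
  by rewrite -expRD; congr expR; field.
rewrite mulrAC ler_pM2r ?expR_gt0//.
have -> : s ^+ k = 2 ^+ k * (2^-1 * s) ^+ k.
  by rewrite -exprMn mulrA divff ?pnatr_eq0// mul1r.
rewrite cE mulrCA ler_pM2l ?exprn_gt0//.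
rewrite expRN mulrC ler_pdivrMr ?expR_gt0//.
by apply: exprn_le_fact_expR; rewrite mulr_ge0.
Qed.

Lemma lap_at0 k :
  lap k (0 : R) = 2 * ((th_der k).[0] * \int[mu]_(s in `[0, +oo[) (expR (- s) * s ^+ k)).
Proof.
rewrite /lap; congr (_ * _); rewrite -RintegralZl//; last exact: moment_integrable.
apply: eq_Rintegral => s _.
by rewrite /lap_fun mul0r th0; ring.
Qed.

(** Only the mass of [M, M + 1] is kept. As M is arbitrary, the moments outgrow
    every geometric sequence. *)
Lemma moment_lower (M : R) k : 0 <= M ->
  M ^+ k * expR (- (M + 1)) <= \int[mu]_(s in `[0, +oo[) (expR (- s) * s ^+ k).
Proof.
move=> M0; set r := M ^+ k * expR (- (M + 1)).
have r0 : 0 <= r by rewrite mulr_ge0 ?expR_ge0 ?exprn_ge0.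
have -> : r = \int[mu]_(s in `[M, M + 1]) r.
  have mu1 : lebesgue_measure (`[M, M + 1]%classic : set R) = 1%:E.
    rewrite lebesgue_measure_itv /= lte_fin ltrDl ltr01.
    by rewrite -EFinD /= (addrC M) addrK.
  by rewrite Rintegral_cst//= [X in fine X]mu1 mulr1.
have MI : `[M, M + 1]%classic = `[0, +oo[%classic `&` `[M, M + 1]%classic :> set R.
  rewrite setIidr// => s; rewrite /= !in_itv/= andbT => /andP[+ _].
  exact: le_trans.
rewrite MI Rintegral_mkcondr.
apply: le_Rintegral => //; last 1 first.
- move=> s; rewrite /= in_itv/= andbT => s0.
  rewrite patchE; case: ifPn => [|_]; last by rewrite mulr_ge0 ?expR_ge0 ?exprn_ge0.
  rewrite inE/= in_itv/= => /andP[Ms sM].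
  rewrite mulrC ler_pM ?expR_ge0 ?exprn_ge0 ?ler_expR ?lerN2//.
  by rewrite lerXn2r ?nnegrE.
- rewrite -restrict_EFin; apply/integrable_restrict => //; rewrite -MI.
  apply: continuous_compact_integrable; first exact: segment_compact.
  by apply: continuous_subspaceT => x; exact: cst_continuous.
- exact: moment_integrable.
Qed.

End LaplaceFacts.

(** * The Taylor coefficients of tanh *)

Section TanhCoefficients.
Context {R : realType}.
Implicit Types (k n m i : nat).

Lemma th_derivM (p q : {poly R}) : th_deriv (p * q) = th_deriv p * q + p * th_deriv q.
Proof. by rewrite /th_deriv derivM; ring. Qed.

Lemma th_derivZ (a : R) (p : {poly R}) : th_deriv (a *: p) = a *: th_deriv p.
Proof. by rewrite /th_deriv derivZ scalerAl. Qed.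

Lemma th_deriv_sum n (F : 'I_n -> {poly R}) : th_deriv (\sum_i F i) = \sum_i th_deriv (F i).
Proof. by rewrite /th_deriv raddf_sum mulr_suml. Qed.

Definition th_taylor k : {poly R} := k`!%:R^-1 *: th_der k.

Lemma th_deriv_taylor k : th_deriv (th_taylor k) = k.+1%:R *: th_taylor k.+1.
Proof.
rewrite /th_taylor th_derivZ scalerA factS natrM invfM mulrA divff ?pnatr_eq0// mul1r.
by [].
Qed.

(** This is th' = (1 - th^2) / 4 read on Taylor coefficients at a variable point;
    keeping polynomials in [th] instead of numbers allows the induction on k to
    differentiate the identity. *)
Lemma th_taylor_riccati k : k.+1%:R *: th_taylor k.+1 =
  (4^-1)%:P * ((k == 0)%:R - \sum_(i < k.+1) th_taylor i * th_taylor (k - i)).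
Proof.
elim: k => [|k IH].
  rewrite -th_deriv_taylor big_ord1 subnn /th_taylor fact0 invr1 !scale1r /th_deriv /= derivX mul1r.
  by rewrite mulrC expr2.
have := congr1 th_deriv IH; rewrite th_derivZ th_deriv_taylor.
have -> : th_deriv ((4^-1)%:P * ((k == 0)%:R - \sum_(i < k.+1) th_taylor i * th_taylor (k - i))) =
   (4^-1)%:P * - \sum_(i < k.+1) th_deriv (th_taylor i * th_taylor (k - i)).
  rewrite -th_deriv_sum /th_deriv derivM derivC mul0r add0r derivB.
  have -> : ((k == 0)%:R : {poly R})^`() = 0 by rewrite derivMn -[1]polyC1 derivC mul0rn.
  rewrite sub0r mulrN mulNr mulrN. by rewrite -mulrA.
rewrite sub0r.
suff -> : \sum_(i < k.+1) th_deriv (th_taylor i * th_taylor (k - i)) =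
   k.+1%:R *: \sum_(i < k.+2) th_taylor i * th_taylor (k.+1 - i).
  move=> h; apply: (@scalerI _ _ (k.+1%:R)); first by rewrite pnatr_eq0.
  by rewrite h mulrN mulrN scalerN scalerAr.
under eq_bigr do rewrite th_derivM !th_deriv_taylor.
rewrite big_split /=.
have -> : \sum_(i < k.+1) i.+1%:R *: th_taylor i.+1 * th_taylor (k - i) =
    \sum_(i < k.+2) i%:R *: (th_taylor i * th_taylor (k.+1 - i)).
  rewrite [RHS]big_ord_recl /= scale0r add0r; apply: eq_bigr => i _.
  by rewrite /bump /= add1n subSS scalerAl.
have -> : \sum_(i < k.+1) th_taylor i * ((k - i).+1%:R *: th_taylor (k - i).+1) =
    \sum_(i < k.+2) (k.+1 - i)%:R *: (th_taylor i * th_taylor (k.+1 - i)).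
  rewrite [RHS]big_ord_recr /= subnn scale0r addr0; apply: eq_bigr => i _.
  have ik : (i <= k)%N by rewrite -ltnS ltn_ord.
  by rewrite subSn// scalerAr.
rewrite -big_split scaler_sumr /=; apply: eq_bigr => i _.
by rewrite -scalerDl -natrD subnKC// -ltnS.
Qed.

Definition th_coef k : R := (th_taylor k).[0].

Lemma th_coef0 : th_coef 0 = 0.
Proof. by rewrite /th_coef /th_taylor hornerZ /= hornerX mulr0. Qed.

Lemma th_coef_rec k : k.+1%:R * th_coef k.+1 =
  4^-1 * ((k == 0)%:R - \sum_(i < k.+1) th_coef i * th_coef (k - i)).
Proof.
have := congr1 (fun p => p.[0]) (th_taylor_riccati k).
rewrite hornerZ hornerM hornerC hornerD hornerN horner_sum => ->.
congr (_ * (_ - _)); first by rewrite hornerMn -[1]polyC1 hornerC.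
by apply: eq_bigr => i _; rewrite hornerM.
Qed.

Lemma sum_ord_double (F : nat -> R) n :
  \sum_(i < n.*2) F i = \sum_(i < n) (F i.*2 + F i.*2.+1).
Proof.
elim: n => [|n IH]; first by rewrite !big_ord0.
by rewrite doubleS 2!big_ord_recr /= IH [RHS]big_ord_recr /= addrA.
Qed.

(** For odd indices all products in the recursion have the same sign, so nothing
    cancels and a geometric lower bound propagates. The step from m to m + 1
    needs q <= (m + 1) / (4 (2 m + 3)), which is smallest at m = 0: hence
    q = 1 / 12. *)
Lemma th_coef_lower m : th_coef m.*2 = 0 /\ 12^-1 ^+ m.*2.+1 <= (-1) ^+ m * th_coef m.*2.+1.
Proof.
elim/ltn_ind: m => -[|m] IH.
  split; first exact: th_coef0.
  have := th_coef_rec 0; rewrite big_ord1 th_coef0 mul0r subr0 mulr1 expr0 !mul1r => ->.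
  by rewrite expr1; lra.
have E i : (i <= m)%N -> th_coef i.*2 = 0 by move=> im; have [] := IH i im.
have O i : (i <= m)%N -> 12^-1 ^+ i.*2.+1 <= (-1) ^+ i * th_coef i.*2.+1.
  by move=> im; have [] := IH i im.
have ev : th_coef m.+1.*2 = 0.
  have := th_coef_rec m.*2.+1; rewrite /= sub0r -doubleS (sum_ord_double (fun i => th_coef i * th_coef (m.*2.+1 - i))).
  rewrite big1; first by rewrite oppr0 mulr0 => /eqP; rewrite mulf_eq0 pnatr_eq0 => /eqP.
  move=> i _; have im : (i <= m)%N by rewrite -ltnS.
  by rewrite E// mul0r add0r subSS -doubleB E ?leq_subr// mulr0.
split => //.
have := th_coef_rec m.+1.*2; rewrite /= sub0r big_ord_recr /= subnn th_coef0 mulr0 addr0.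
rewrite (sum_ord_double (fun i => th_coef i * th_coef (m.+1.*2 - i))).
move=> h.
have hs : m.+1%:R * 12^-1 ^+ m.+1.*2 <=
   (-1) ^+ m * \sum_(i < m.+1) (th_coef i.*2 * th_coef (m.+1.*2 - i.*2) + th_coef i.*2.+1 * th_coef (m.+1.*2 - i.*2.+1)).
  have -> : m.+1%:R * 12^-1 ^+ m.+1.*2 = \sum_(i < m.+1) 12^-1 ^+ m.+1.*2 :> R.
    by rewrite sumr_const card_ord mulr_natl.
  rewrite mulr_sumr; apply: ler_sum => i _.
  have im : (i <= m)%N by rewrite -ltnS.
  rewrite E// mul0r add0r.
  have e1 : (m.+1.*2 - i.*2.+1 = (m - i).*2.+1)%N by lia.
  rewrite e1.
  have -> : (-1) ^+ m * (th_coef i.*2.+1 * th_coef (m - i).*2.+1) =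
    ((-1) ^+ i * th_coef i.*2.+1) * ((-1) ^+ (m - i) * th_coef (m - i).*2.+1).
    by rewrite -{1}(subnKC im) exprD; ring.
  have -> : 12^-1 ^+ m.+1.*2 = 12^-1 ^+ i.*2.+1 * 12^-1 ^+ (m - i).*2.+1 :> R.
    by rewrite -exprD; congr (_ ^+ _); lia.
  by apply: ler_pM; rewrite ?exprn_ge0 ?invr_ge0 ?O ?leq_subr.
set S := (\sum_(i < m.+1) _) in h hs *.
have k0 : 0 < m.+1.*2.+1%:R :> R by rewrite ltr0n.
rewrite -(ler_pM2l k0).
have -> : m.+1.*2.+1%:R * ((-1) ^+ m.+1 * th_coef m.+1.*2.+1) = 4^-1 * ((-1) ^+ m * S).
  by rewrite mulrCA h exprS; ring.
apply: (@le_trans _ _ (4^-1 * (m.+1%:R * 12^-1 ^+ m.+1.*2))); last first.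
  by rewrite ler_pM2l ?invr_gt0.
have -> : m.+1.*2.+1%:R = 2 * m.+1%:R + 1 :> R.
  by rewrite -addn1 natrD -mul2n natrM.
rewrite [_ ^+ m.+1.*2.+1]exprSr; set q := _ ^+ m.+1.*2.
have q0 : 0 < q by rewrite exprn_gt0 ?invr_gt0.
rewrite mulrCA [leRHS]mulrCA [leRHS]mulrCA.
rewrite [leRHS](_ : _ = q * (m.+1%:R / 4)); last by ring.
rewrite ler_pM2l//.
have : 1 <= m.+1%:R :> R by rewrite ler1n.
lra.
Qed.

End TanhCoefficients.

(** * Taylor expansions of the Laplace transform *)

Section Taylor.
Context {R : realType}.
Implicit Types (s t u x y c : R) (k n m : nat).

Lemma mvt_ex (F F' : R -> R) (a b : R) : a < b ->
  (forall x, a <= x <= b -> is_derive x 1 F (F' x)) ->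
  exists2 c, a < c < b & F b - F a = F' c * (b - a).
Proof.
move=> ab dF.
have [c cab ->] : exists2 c, c \in `]a, b[ & F b - F a = F' c * (b - a).
  apply: MVT => //.
    move=> x; rewrite in_itv/= => /andP[ax xb]; apply: dF.
    by rewrite !ltW.
  apply: derivable_within_continuous => x; rewrite in_itv/= => /dF.
  by case.
by exists c => //; move: cab; rewrite in_itv.
Qed.

Lemma mvt_le (F F' : R -> R) (a b B : R) : a <= b ->
  (forall x, a <= x <= b -> is_derive x 1 F (F' x)) ->
  (forall x, a <= x <= b -> `|F' x| <= B) ->
  `|F b - F a| <= B * (b - a).
Proof.
rewrite le_eqVlt => /predU1P[-> _ _|ab dF F'B].
  by rewrite !subrr normr0 mulr0.
have [c /andP[ac cb] ->] := mvt_ex ab dF.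
have ba : 0 < b - a by rewrite subr_gt0.
rewrite normrM (gtr0_norm ba) ler_wpM2r//; first exact: ltW.
by apply: F'B; rewrite !ltW.
Qed.

Lemma lap_bounded k : exists C, forall t, `|lap k t| <= C.
Proof.
have [G [G0 iG GP]] := @lap_fun_dominated R k.
exists (2 * \int[lebesgue_measure]_(s in `[0, +oo[) G s) => t.
rewrite /lap normrM (ger0_norm (ler0n _ 2)) ler_wpM2l//.
have i := @lap_fun_integrable R k t.
apply: (le_trans (le_normr_Rintegral _ _)) => //.
apply: le_Rintegral => //.
  have := @integrable_abse _ _ _ lebesgue_measure `[0%R, +oo[%classic _ i.
  by apply.
by move=> s; rewrite /= in_itv/= andbT; exact: GP.
Qed.

(** By induction on N for all k at once: the derivative of the remainder of order
    N + 1 of [lap k] is the remainder of order N of [lap k.+1]. *)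
Lemma lap_taylor N k : exists C, forall t,
  `|lap k t - \sum_(j < N) lap (k + j) 0 / j`!%:R * t ^+ j| <= C * `|t| ^+ N.
Proof.
elim: N k => [|N IH] k.
  have [C hC] := lap_bounded k; exists C => t.
  by rewrite big_ord0 subr0 expr0 mulr1.
have [C hC] := IH k.+1.
exists C => t.
pose F u : R := lap k u - \sum_(j < N.+1) lap (k + j) 0 / j`!%:R * u ^+ j.
pose F' u : R := lap k.+1 u - \sum_(j < N) lap (k.+1 + j) 0 / j`!%:R * u ^+ j.
have dF x : is_derive x 1 F (F' x).
  have dX j : is_derive x 1 (fun u => lap (k + j) 0 / j`!%:R * u ^+ j)
      (lap (k + j) 0 / j`!%:R * (j%:R * x ^+ j.-1)).
    have -> : (fun u => lap (k + j) 0 / j`!%:R * u ^+ j) =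
       (fun u => (lap (k + j) 0 / j`!%:R) *: (@id R ^+ j) u).
      by apply/funext => u; rewrite /GRing.scale /= fctE.
    apply: is_derive_eq; rewrite /GRing.scale /= mulr1.
    by rewrite -mulr_natl.
  have dS : is_derive x 1 (fun u => \sum_(j < N.+1) lap (k + j) 0 / j`!%:R * u ^+ j)
      (\sum_(j < N) lap (k.+1 + j) 0 / j`!%:R * x ^+ j).
    have -> : (fun u => \sum_(j < N.+1) lap (k + j) 0 / j`!%:R * u ^+ j) =
       \sum_(j < N.+1) (fun u => lap (k + j) 0 / j`!%:R * u ^+ j).
      by apply/funext => u; rewrite fct_sumE.
    apply: (is_derive_eq (is_derive_sum (fun j : 'I_N.+1 => dX j))).
    rewrite big_ord_recl /= mul0r mulr0 add0r; apply: eq_bigr => j _.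
    rewrite /bump /= add1n addnS addSn -addSn factS natrM invfM.
    have := @lt0r_neq0 R _ (ltr0Sn R j) => j0.
    have j1 : j`!%:R != 0 :> R by rewrite pnatr_eq0 -lt0n fact_gt0.
    by field; rewrite j1 /= ?andbT ?nat1r ?natr1 pnatr_eq0.
  exact: (is_deriveB (is_derive_lap k x) dS).
have F0 : F 0 = 0.
  rewrite /F big_ord_recl /= fact0 invr1 expr0 !mulr1 addn0 big1 ?addr0 ?subrr// => j _.
  by rewrite /bump /= add1n expr0n mulr0.
have bF x : `|x| <= `|t| -> `|F' x| <= C * `|t| ^+ N.
  move=> xt; apply: (le_trans (hC x)).
  have C0 : 0 <= C.
    have := le_trans (normr_ge0 _) (hC 1).
    by rewrite normr1 expr1n mulr1.
  by rewrite ler_wpM2l// lerXn2r ?nnegrE.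
rewrite -/(F t) exprSr mulrA.
have [t0|t0] := leP 0 t.
  rewrite -[F t]subr0 -F0 [X in _ * X](_ : _ = t - 0); last by rewrite subr0 ger0_norm.
  apply: (@mvt_le F F') => // x /andP[x0 xt]; apply: bF.
  by rewrite !ger0_norm.
have -> : `|F t| = `|F 0 - F t| by rewrite F0 sub0r normrN.
rewrite [X in _ * X](_ : _ = 0 - t); last by rewrite sub0r ltr0_norm.
apply: (@mvt_le F F'); rewrite ?ltW// => x /andP[tx x0]; apply: bF.
by rewrite !ler0_norm ?lerN2// ltW.
Qed.

(** The k-th Taylor coefficient of [lap 0] is twice that of [th] times the k-th
    moment of exp(- s). The first factor is at least 12^-k for odd k, and
    [moment_lower] at 12 M makes up for it. *)
Lemma lap_superexp (M : R) : 0 <= M ->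
  exists2 c : R, 0 < c & forall m,
    c * M ^+ m.*2.+1 <= `|lap m.*2.+1 0 / m.*2.+1`!%:R|.
Proof.
move=> M0; exists (2 * expR (- (12 * M + 1))).
  by rewrite mulr_gt0// expR_gt0.
move=> m; set k := m.*2.+1.
have f0 : 0 < k`!%:R :> R by rewrite ltr0n fact_gt0.
have -> : lap k 0 / k`!%:R = 2 * th_coef k *
    (\int[lebesgue_measure]_(s in `[0, +oo[) (expR (- s) * s ^+ k)) :> R.
  by rewrite lap_at0 /th_coef /th_taylor hornerZ; ring.
rewrite !normrM (ger0_norm (ler0n _ 2)) -!mulrA ler_pM2l//.
have M12 : 0 <= 12 * M by rewrite mulr_ge0.
have J := moment_lower k M12.
have [_ W] := @th_coef_lower R m.
have W' : 12^-1 ^+ k <= `|th_coef k| :> R.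
  apply: (le_trans W); apply: (le_trans (ler_norm _)).
  by rewrite normrM normrX normrN normr1 expr1n mul1r.
apply: (@le_trans _ _ (12^-1 ^+ k * ((12 * M) ^+ k * expR (- (12 * M + 1))))).
  by rewrite mulrA -exprMn mulrA mulVf ?pnatr_eq0// mul1r mulrC.
apply: ler_pM => //; rewrite ?exprn_ge0 ?invr_ge0 ?mulr_ge0 ?expR_ge0 ?exprn_ge0//.
exact: (le_trans J (ler_norm _)).
Qed.

End Taylor.

#[local] Opaque lap.

(** * Convergent power series from homogeneous sums *)

Section PowerSeries.
Context {R : realType}.
Implicit Types (x y c K q : R) (i j k n m : nat) (p : R * R) (a b : nat -> nat -> R).

Lemma eq_cvgn (u v : nat -> R) (l : R) : (forall n, v n = u n) ->
  u @ \oo --> l -> v @ \oo --> l.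
Proof. by move=> uv; rewrite (_ : v = u)//; exact/funext. Qed.

Lemma cvgn_le (u : nat -> R) (l B : R) : u @ \oo --> l ->
  (forall n, u n <= B) -> l <= B.
Proof.
move=> c h; rewrite -(cvg_lim (@Rhausdorff R) c); apply: limr_le.
  exact: cvgP c.
exact: nearW.
Qed.

Lemma norm_fst_le p : `|p.1| <= `|p|.
Proof. by rewrite /Num.norm /= le_max lexx. Qed.

Lemma norm_snd_le p : `|p.2| <= `|p|.
Proof. by rewrite /Num.norm /= le_max lexx orbT. Qed.

Lemma triangle_sum (F : nat -> nat -> R) n :
  \sum_(k < n) \sum_(i < k.+1) F i (k - i)%N = \sum_(i < n) \sum_(j < n - i) F i j.
Proof.
elim: n => [|n IH]; first by rewrite !big_ord0.
rewrite big_ord_recr /= IH [in RHS]big_ord_recr /= subSnn big_ord1.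
rewrite [X in _ + X]big_ord_recr /= subnn addrA; congr (_ + _).
rewrite -big_split /=; apply: eq_bigr => i _.
by rewrite subSn 1?ltnW// big_ord_recr.
Qed.

Lemma sum_geo2 n : \sum_(i < n) 2^-1 ^+ i <= 2 :> R.
Proof.
suff -> : \sum_(i < n) 2^-1 ^+ i = 2 - 2 * 2^-1 ^+ n :> R.
  by rewrite gerBl mulr_ge0// exprn_ge0// invr_ge0.
elim: n => [|n IH]; first by rewrite big_ord0 expr0; ring.
by rewrite big_ord_recr /= IH exprS; field.
Qed.

Lemma double_geo2 n K : 0 <= K ->
  \sum_(i < n) \sum_(j < n) K * 2^-1 ^+ (i + j) <= 4 * K.
Proof.
move=> K0.
have -> : \sum_(i < n) \sum_(j < n) K * 2^-1 ^+ (i + j) =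
    K * ((\sum_(i < n) 2^-1 ^+ i) * (\sum_(j < n) 2^-1 ^+ j)).
  rewrite mulr_suml mulr_sumr; apply: eq_bigr => i _.
  rewrite !mulr_sumr; apply: eq_bigr => j _; by rewrite exprD.
have s0 : 0 <= \sum_(i < n) 2^-1 ^+ i :> R.
  by apply: sumr_ge0 => i _; rewrite exprn_ge0// invr_ge0.
rewrite mulrC ler_wpM2r// (_ : 4 = 2 * 2); last by ring.
by apply: ler_pM => //; exact: sum_geo2.
Qed.

Definition abs_sum a p n := \sum_(i < n) \sum_(j < n) `|a i j * p.1 ^+ i * p.2 ^+ j|.

Lemma abs_sum_nd a p : nondecreasing_seq (abs_sum a p).
Proof.
apply/nondecreasing_seqP => n; rewrite /abs_sum [leRHS]big_ord_recr /=.
apply: (@le_trans _ _ (\sum_(i < n) \sum_(j < n.+1) `|a i j * p.1 ^+ i * p.2 ^+ j|)).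
  by apply: ler_sum => i _; rewrite big_ord_recr /= lerDl.
by rewrite lerDl; apply: sumr_ge0.
Qed.

Lemma abs_sum_cvg a p B : (forall n, abs_sum a p n <= B) -> cvgn (abs_sum a p).
Proof.
move=> h; apply: nondecreasing_is_cvgn; first exact: abs_sum_nd.
by exists B => _ [n _ <-]; exact: h.
Qed.

(** Convergence along sums of homogeneous parts is what one gets from a geometric
    series in a linear form; with a geometric bound on the coefficients it
    implies absolute convergence over squares. The ratio 2 is the one of the
    binomial coefficients. *)
Definition geo_series a (f : R * R -> R) :=
  (exists2 K, 0 <= K & forall i j, `|a i j| <= K * 2 ^+ (i + j)) /\
  (forall p, `|p| < 8^-1 ->
    (fun n => \sum_(k < n) \sum_(i < k.+1) a i (k - i)%N * p.1 ^+ i * p.2 ^+ (k - i))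
     @ \oo --> f p).

Lemma geo_seriesD a b f g : geo_series a f -> geo_series b g ->
  geo_series (fun i j => a i j + b i j) (fun p => f p + g p).
Proof.
move=> [[K K0 aK] af] [[L L0 bL] bg]; split.
  exists (K + L); first exact: addr_ge0.
  move=> i j; apply: (le_trans (ler_normD _ _)).
  by rewrite mulrDl lerD.
move=> p pr; apply: eq_cvgn (cvgD (af p pr) (bg p pr)) => n.
rewrite /= ?fctE -big_split /=; apply: eq_bigr => k _.
by rewrite -big_split /=; apply: eq_bigr => i _; rewrite !mulrDl.
Qed.

Lemma geo_seriesZ c a f : geo_series a f ->
  geo_series (fun i j => c * a i j) (fun p => c * f p).
Proof.
move=> [[K K0 aK] af]; split.
  exists (`|c| * K); first exact: mulr_ge0.
  by move=> i j; rewrite normrM -mulrA ler_wpM2l.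
move=> p pr; apply: eq_cvgn (cvgM (cvg_cst c) (af p pr)) => n.
rewrite /= ?fctE mulr_sumr; apply: eq_bigr => k _.
by rewrite mulr_sumr; apply: eq_bigr => i _; rewrite !mulrA.
Qed.

Lemma geo_series_term a K p i j : 0 <= K -> (forall i j, `|a i j| <= K * 2 ^+ (i + j)) ->
  `|p| < 8^-1 -> `|a i j * p.1 ^+ i * p.2 ^+ j| <= K * 4^-1 ^+ (i + j).
Proof.
move=> K0 aK /ltW p8; rewrite !normrM !normrX.
have -> : K * 4^-1 ^+ (i + j) = K * 2 ^+ (i + j) * 8^-1 ^+ i * 8^-1 ^+ j.
  by rewrite -!mulrA -exprD -exprMn; congr (_ * _ ^+ _); field.
have e0 : 0 <= 8^-1 :> R by rewrite invr_ge0.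
apply: ler_pM; rewrite ?mulr_ge0 ?exprn_ge0//.
  apply: ler_pM; rewrite ?mulr_ge0 ?exprn_ge0//.
  by rewrite lerXn2r ?nnegrE// (le_trans (norm_fst_le _)).
by rewrite lerXn2r ?nnegrE// (le_trans (norm_snd_le _)).
Qed.

(** The terms of a square that are missing from the triangle have total degree at
    least n, and the factor 4^-(i + j) leaves 2^-n for their sum. *)
Lemma geo_series_psum a f : geo_series a f -> is_psum a 8^-1 f.
Proof.
move=> [[K K0 aK] af] p p8; pose T i j := a i j * p.1 ^+ i * p.2 ^+ j.
have TK i j : `|T i j| <= K * 4^-1 ^+ (i + j) by exact: geo_series_term.
have h2 : 0 <= 2^-1 :> R by rewrite invr_ge0.
have T2 i j : `|T i j| <= K * 2^-1 ^+ (i + j).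
  apply: (le_trans (TK i j)); rewrite ler_wpM2l//.
  by rewrite lerXn2r ?nnegrE ?invr_ge0// lef_pV2 ?posrE// ler_nat.
split.
  apply: (@abs_sum_cvg a p (4 * K)) => n; apply: le_trans (double_geo2 n K0).
  by apply: ler_sum => i _; apply: ler_sum => j _; exact: T2.
have := af p p8.
under eq_fun do rewrite (triangle_sum T).
move=> h.
suff : (fun n => \sum_(i < n) \sum_(j < n) T i j - \sum_(i < n) \sum_(j < n - i) T i j)
    @ \oo --> 0.
  move=> h0; rewrite -[f p]add0r; apply: eq_cvgn (cvgD h0 h) => n.
  by rewrite /= ?fctE subrK.
apply/norm_cvg0P.
apply: (@squeeze_cvgr _ _ _ _ (fun=> 0) (fun n => 4 * K * 2^-1 ^+ n)).
- near=> n; rewrite normr_ge0 /= -sumrB.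
  apply: (@le_trans _ _ (\sum_(i < n) \sum_(j < n) (K * 2^-1 ^+ n) * 2^-1 ^+ (i + j))); last first.
    apply: (le_trans (double_geo2 n _)); first by rewrite mulr_ge0// exprn_ge0.
    by rewrite mulrA.
  apply: (le_trans (ler_norm_sum _ _ _)); apply: ler_sum => i _.
  rewrite (@big_ord_widen _ _ _ (n - i) n (fun j => T i j)) ?leq_subr//.
  rewrite (bigID (fun j : 'I_n => (j < n - i)%N)) /= addrAC subrr add0r.
  apply: (le_trans (ler_norm_sum _ _ _)).
  rewrite [leRHS](bigID (fun j : 'I_n => (j < n - i)%N)) /= -[leLHS]add0r lerD//.
    by apply: sumr_ge0 => j _; rewrite !mulr_ge0// exprn_ge0.
  apply: ler_sum => j; rewrite -leqNgt => nij.
  apply: (le_trans (TK i j)); rewrite -mulrA ler_wpM2l// -exprD.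
  have -> : 4^-1 = 2^-1 * 2^-1 :> R by field.
  rewrite exprMn -exprD ler_wiXn2l ?invr_ge0 ?invf_le1 ?ler1n//.
  by rewrite leq_add2r -leq_subLR.
- exact: cvg_cst.
- rewrite -[X in _ --> X](mulr0 (4 * K)); apply: cvgMr.
  by apply: cvg_expr; rewrite ger0_norm ?invr_ge0// invf_lt1// ltr1n.
Unshelve. all: by end_near. Qed.

Definition lin_coef c1 c2 i j : R :=
  if (i, j) == (1, 0)%N then c1 else if (i, j) == (0, 1)%N then c2 else 0.

Lemma geo_series_lin c1 c2 : geo_series (lin_coef c1 c2) (fun p => c1 * p.1 + c2 * p.2).
Proof.
split.
  exists (`|c1| + `|c2|); first exact: addr_ge0.
  move=> i j; rewrite /lin_coef; set s := _ + _.
  have s0 : 0 <= s * 2 ^+ (i + j) by rewrite mulr_ge0 ?addr_ge0 ?exprn_ge0.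
  case: ifPn => [/eqP[-> ->]|_].
    by rewrite expr1 /s mulrDl; have := normr_ge0 c1; have := normr_ge0 c2; lra.
  case: ifPn => [/eqP[-> ->]|_]; last by rewrite normr0.
  by rewrite expr1 /s mulrDl; have := normr_ge0 c1; have := normr_ge0 c2; lra.
move=> p _; apply: cvg_near_cst; near=> n.
have n2 : (1 < n)%N by near: n; exists 2%N.
rewrite (triangle_sum (fun i j => lin_coef c1 c2 i j * p.1 ^+ i * p.2 ^+ j)).
have -> : n = (n - 2).+2 by lia.
move: (n - 2)%N => m.
pose F i j := lin_coef c1 c2 i j * p.1 ^+ i * p.2 ^+ j.
have G0 : \sum_(j < m.+2) F 0%N j = c2 * p.2.
  rewrite 2!big_ord_recl big1 => [|i _]; last by rewrite /F /lin_coef !mul0r.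
  by rewrite /F /lin_coef /= expr0 expr1; ring.
have G1 : \sum_(j < m.+1) F 1%N j = c1 * p.1.
  rewrite big_ord_recl big1 => [|i _]; last by rewrite /F /lin_coef !mul0r.
  by rewrite /F /lin_coef /= expr0 expr1; ring.
have G2 i k : \sum_(j < k) F i.+2 j = 0.
  by rewrite big1 // => j _; rewrite /F /lin_coef !mul0r.
rewrite 2!big_ord_recl subn0 [X in X + _]G0 subSS subn0 [X in _ + (X + _)]G1.
by rewrite big1 => [|i _]; [ring|exact: G2].
Unshelve. all: by end_near. Qed.

(** The coefficients of y / (1 + x + c y), which is y times the geometric series
    of the linear form - (x + c y). *)
Definition ygeo_coef c i j : R :=
  if j is j'.+1 then (-1) ^+ (i + j') * 'C(i + j', i)%:R * c ^+ j' else 0.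

Lemma geo_series_ygeo c : `|c| <= 1 ->
  geo_series (ygeo_coef c) (fun p => p.2 / (1 + p.1 + c * p.2)).
Proof.
move=> c1; split.
  exists 1 => // i [|j]; rewrite mul1r /= ?normr0 ?exprn_ge0//.
  rewrite !normrM normrX normrN normr1 expr1n mul1r normrX ger0_norm//.
  apply: (@le_trans _ _ ('C(i + j, i)%:R * 1)).
    by rewrite ler_wpM2l// exprn_ile1.
  rewrite mulr1 addnS -natrX ler_nat.
  apply: (@leq_trans (2 ^ (i + j))); last by rewrite leq_exp2l.
  have := expnDn 1 1 (i + j); rewrite addn1 => ->.
  have ij : (i < (i + j).+1)%N by rewrite ltnS leq_addr.
  rewrite (bigD1 (Ordinal ij)) //= !exp1n !muln1.
  exact: leq_addr.
move=> p p8.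
pose z := - (p.1 + c * p.2).
have z1 : `|z| < 1.
  rewrite /z normrN; apply: (le_lt_trans (ler_normD _ _)); rewrite normrM.
  have := norm_fst_le p; have := norm_snd_le p => h1 h2.
  have h3 : `|c| * `|p.2| <= `|p.2| by rewrite ler_piMl.
  by move: p8 => /=; lra.
have -> : p.2 / (1 + p.1 + c * p.2) = p.2 * (1 - z)^-1.
  by rewrite /z opprK addrA.
rewrite -(cvg_shiftS (fun n => \sum_(k < n) _)).
apply: eq_cvgn (@cvg_geometric_series R p.2 z z1) => n.
rewrite /series /= big_mkord big_ord_recl /= big_ord1 /= !mul0r add0r.
apply: eq_bigr => k _; rewrite /geometric /bump /= add1n.
rewrite big_ord_recr /= subnn !mul0r addr0.
have -> : z = - p.1 + - (c * p.2) by rewrite /z opprD.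
rewrite exprDn mulr_sumr [RHS](reindex_inj rev_ord_inj) /=.
apply: eq_bigr => i _; have ik : (i <= k)%N by rewrite -ltnS.
rewrite subSS subKn// !subSn// /=.
rewrite addnC subnK// exprS -[c * p.2]mulrC -[- (_ * _)]mulrN exprMn bin_sub//.
rewrite (exprNn p.1) (exprNn c) -mulr_natr.
have -> : (-1) ^+ k = (-1) ^+ i * (-1) ^+ (k - i) :> R by rewrite -exprD subnKC.
by ring.
Qed.

End PowerSeries.

(** * Regularity of convergent power series *)

Section PsumRegularity.
Context {R : realType}.
Implicit Types (x y c K q rho : R) (i j k n m : nat) (p : R * R) (a b : nat -> nat -> R).

(** Cauchy's estimate: at a point of the diagonal no term exceeds the sum of
    absolute values. *)
Lemma psum_coef_bound a r f : 0 < r -> is_psum a r f ->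
  exists K q, [/\ 1 <= K, 1 <= q & forall i j, `|a i j| <= K * q ^+ (i + j)].
Proof.
move=> r0 af; pose s := r / 2.
have s0 : 0 < s by rewrite divr_gt0.
pose p : R * R := (s, s).
have pr : `|p| < r.
  have -> : `|p| = Num.max `|s| `|s| by [].
  rewrite maxxx gtr0_norm// /s.
  by rewrite ltr_pdivrMr// ltr_pMr// ltr1n.
have [cA _] := af p pr.
pose B := limn (abs_sum a p).
have hB n : abs_sum a p n <= B by apply: nondecreasing_cvgn_le => //; exact: abs_sum_nd.
exists (1 + `|B|), (1 + s^-1); split; first by rewrite lerDl.
  by rewrite lerDl invr_ge0 ltW.
move=> i j.
have t : `|a i j * s ^+ i * s ^+ j| <= B.
  apply: le_trans (hB (i + j).+1).
  have hi : (i < (i + j).+1)%N by rewrite ltnS leq_addr.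
  have hj : (j < (i + j).+1)%N by rewrite ltnS leq_addl.
  rewrite /abs_sum (bigD1 (Ordinal hi)) //= (bigD1 (Ordinal hj)) //=.
  rewrite -addrA lerDl addr_ge0// ?sumr_ge0// => k _; exact: sumr_ge0.
have : `|a i j| <= B * s^-1 ^+ (i + j).
  rewrite exprVn ler_pdivlMr ?exprn_gt0//; apply: le_trans t.
  by rewrite -mulrA -exprD normrM (ger0_norm (exprn_ge0 _ (ltW s0))).
move=> /le_trans; apply; apply: ler_pM.
- exact: (le_trans (normr_ge0 _) t).
- by rewrite exprn_ge0// invr_ge0 ltW.
- by apply: (le_trans (ler_norm _)); rewrite lerDr.
- rewrite lerXn2r ?nnegrE ?invr_ge0 ?addr_ge0 ?invr_ge0 ?(ltW s0)//.
  by rewrite lerDr.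
Qed.

Lemma monomial_lip x x' rho d i : 0 <= rho -> `|x| <= rho -> `|x'| <= rho ->
  `|x - x'| <= d -> `|x ^+ i - x' ^+ i| * rho <= i%:R * rho ^+ i * d.
Proof.
move=> r0 xr xr' xd; elim: i => [|i IH].
  by rewrite !expr0 subrr normr0 !mul0r.
have -> : x ^+ i.+1 - x' ^+ i.+1 = x ^+ i * (x - x') + (x ^+ i - x' ^+ i) * x'.
  by rewrite !exprSr; ring.
have d0 : 0 <= d by exact: le_trans (normr_ge0 _) xd.
have h1 : `|x ^+ i * (x - x')| <= rho ^+ i * d.
  by rewrite normrM normrX ler_pM ?exprn_ge0// lerXn2r ?nnegrE.
have h2 : `|(x ^+ i - x' ^+ i) * x'| * rho <= i%:R * rho ^+ i * d * rho.
  rewrite normrM mulrAC; apply: ler_pM => //; exact: mulr_ge0.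
have := ler_normD (x ^+ i * (x - x')) ((x ^+ i - x' ^+ i) * x').
move=> /(ler_wpM2r r0) /le_trans; apply.
rewrite mulrDl; apply: (le_trans (lerD (ler_wpM2r r0 h1) h2)).
rewrite -natr1 exprSr le_eqVlt; apply/orP; left; apply/eqP; ring.
Qed.

Lemma monomial2_lip x y x' y' rho d i j : 0 <= rho ->
  `|x| <= rho -> `|x'| <= rho -> `|y| <= rho -> `|y'| <= rho ->
  `|x - x'| <= d -> `|y - y'| <= d ->
  `|x ^+ i * y ^+ j - x' ^+ i * y' ^+ j| * rho <= (i + j)%:R * rho ^+ (i + j) * d.
Proof.
move=> r0 xr xr' yr yr' xd yd.
have -> : x ^+ i * y ^+ j - x' ^+ i * y' ^+ j =
   x ^+ i * (y ^+ j - y' ^+ j) + (x ^+ i - x' ^+ i) * y' ^+ j by ring.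
apply: (le_trans (ler_wpM2r r0 (ler_normD _ _))).
rewrite mulrDl !normrM -mulrA [X in _ + X]mulrAC.
have h1 := monomial_lip j r0 yr yr' yd.
have h2 := monomial_lip i r0 xr xr' xd.
have X : `|x ^+ i| <= rho ^+ i by rewrite normrX lerXn2r ?nnegrE.
have Y : `|y' ^+ j| <= rho ^+ j by rewrite normrX lerXn2r ?nnegrE.
apply: (@le_trans _ _ (rho ^+ i * (j%:R * rho ^+ j * d) + (i%:R * rho ^+ i * d) * rho ^+ j)).
  apply: lerD; apply: ler_pM => //; by rewrite mulr_ge0.
rewrite natrD exprD le_eqVlt; apply/orP; left; apply/eqP; ring.
Qed.

Lemma natr_le_expr2 n : n%:R <= 2 ^+ n :> R.
Proof. by rewrite -natrX ler_nat ltnW// ltn_expl. Qed.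

(** For a series of order d the Lipschitz constant on a square of size rho is
    O(rho^(d - 1)); for d = 2 it is as small as desired. *)
Lemma psum_lip a r f K q d rho (z w : R * R) :
  is_psum a r f -> 1 <= K -> 1 <= q -> (forall i j, `|a i j| <= K * q ^+ (i + j)) ->
  (forall i j, (i + j < d)%N -> a i j = 0) -> 0 <= rho -> rho < r -> 4 * q * rho <= 1 ->
  `|z| <= rho -> `|w| <= rho ->
  `|f z - f w| * rho <= 4 * K * (4 * q * rho) ^+ d * `|z - w|.
Proof.
move=> af K1 q1 aK ad r0 rr qr zr wr.
have [_ cz] := af z (le_lt_trans zr rr).
have [_ cw] := af w (le_lt_trans wr rr).
apply: (cvgn_le (cvgM (cvg_norm (cvgB cz cw)) (cvg_cst rho))) => n.
set u := 4 * q * rho; set D := `|z - w|.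
have q0 : 0 <= q by lra.
have u0 : 0 <= u by rewrite /u !mulr_ge0.
have D0 : 0 <= D by exact: normr_ge0.
have L0 : 0 <= K * u ^+ d * D by rewrite !mulr_ge0 ?exprn_ge0//; lra.
rewrite [leRHS](_ : _ = 4 * (K * u ^+ d * D)); last by ring.
apply: le_trans (double_geo2 n L0); rewrite /= ?fctE -sumrB.
apply: (le_trans (ler_wpM2r r0 (ler_norm_sum _ _ _))).
rewrite mulr_suml; apply: ler_sum => i _.
rewrite -sumrB; apply: (le_trans (ler_wpM2r r0 (ler_norm_sum _ _ _))).
rewrite mulr_suml; apply: ler_sum => j _.
rewrite -!mulrA -mulrBr normrM -mulrA.
have [ij|ij] := ltnP (i + j) d.
  rewrite ad// normr0 mul0r mulr_ge0//; first lra.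
  by rewrite !mulr_ge0 ?exprn_ge0 ?invr_ge0.
have [f1 s1] := (le_trans (norm_fst_le z) zr, le_trans (norm_snd_le z) zr).
have [f2 s2] := (le_trans (norm_fst_le w) wr, le_trans (norm_snd_le w) wr).
have M := @monomial2_lip z.1 z.2 w.1 w.2 rho D i j r0 f1 f2 s1 s2
  (norm_fst_le (z - w)) (norm_snd_le (z - w)).
have N2 := natr_le_expr2 (i + j).
apply: (@le_trans _ _ (K * q ^+ (i + j) * (2 ^+ (i + j) * rho ^+ (i + j) * D))).
  apply: ler_pM => //; first by rewrite mulr_ge0.
  by apply: (le_trans M); rewrite !ler_wpM2r ?exprn_ge0.
have -> : K * q ^+ (i + j) * (2 ^+ (i + j) * rho ^+ (i + j) * D) =
  K * (u ^+ (i + j) * (D * 2^-1 ^+ (i + j))).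
  rewrite /u !exprMn (_ : 4 = 2 * 2); last by ring.
  rewrite exprMn exprVn; field.
  by rewrite expf_neq0.
rewrite ler_wpM2l//; first lra.
rewrite ler_wpM2r ?mulr_ge0 ?exprn_ge0 ?invr_ge0//.
exact: ler_wiXn2l.
Qed.

End PsumRegularity.

(** * Asymptotic expansions in powers of y *)

Section Expansions.
Context {R : realType}.
Implicit Types (x y c K q rho : R) (i j k n m N : nat) (e d : nat -> R -> R) (F G : R -> R -> R).

(** Boundedness is included because Lipschitz functions alone are not closed
    under products. *)
Definition lipb rho (g : R -> R) := exists2 L, 0 <= L &
  forall x x', `|x| < rho -> `|x'| < rho -> `|g x| <= L /\ `|g x - g x'| <= L * `|x - x'|.

Lemma lipb_cst rho c : lipb rho (fun=> c).
Proof.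
exists `|c| => // x x' _ _; split => //.
by rewrite subrr normr0 mulr_ge0.
Qed.

Lemma lipbD rho g h : lipb rho g -> lipb rho h -> lipb rho (fun x => g x + h x).
Proof.
move=> [L L0 gL] [M M0 hM]; exists (L + M); first exact: addr_ge0.
move=> x x' xr xr'; have [g1 g2] := gL _ _ xr xr'; have [h1 h2] := hM _ _ xr xr'.
split; first by apply: (le_trans (ler_normD _ _)); exact: lerD.
rewrite opprD addrACA mulrDl; apply: (le_trans (ler_normD _ _)); exact: lerD.
Qed.

Lemma lipbM rho g h : lipb rho g -> lipb rho h -> lipb rho (fun x => g x * h x).
Proof.
move=> [L L0 gL] [M M0 hM]; exists (L * M + (L * M + L * M)).
  by rewrite !addr_ge0 ?mulr_ge0.
move=> x x' xr xr'; have [g1 g2] := gL _ _ xr xr'; have [h1 h2] := hM _ _ xr xr'.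
have [h1' _] := hM _ _ xr' xr.
have LM : 0 <= L * M by exact: mulr_ge0.
split.
  rewrite normrM; apply: (@le_trans _ _ (L * M)); first exact: ler_pM.
  by rewrite lerDl addr_ge0.
have -> : g x * h x - g x' * h x' = g x * (h x - h x') + (g x - g x') * h x' by ring.
apply: (le_trans (ler_normD _ _)); rewrite [leRHS]mulrDl -[leLHS]add0r.
apply: lerD; first exact: mulr_ge0.
rewrite !normrM mulrDl -!mulrA; apply: lerD; first exact: ler_pM.
by rewrite (mulrC M) mulrA; exact: ler_pM.
Qed.

Lemma lipb_sum rho n (g : 'I_n -> R -> R) : (forall i : 'I_n, lipb rho (g i)) ->
  lipb rho (fun x => \sum_(i < n) g i x).
Proof.
elim: n g => [|n IH] g h.
  rewrite (_ : (fun _ => _) = fun=> 0); first exact: lipb_cst.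
  by apply/funext => x; rewrite big_ord0.
rewrite (_ : (fun _ => _) = fun x => \sum_(i < n) g (widen_ord (leqnSn n) i) x + g ord_max x).
  by apply: lipbD => //; exact: IH.
by apply/funext => x; rewrite big_ord_recr.
Qed.

Lemma lipb_inv rho : rho <= 2^-1 -> lipb rho (fun x => (1 + x)^-1).
Proof.
move=> r2; exists 4 => // x x' xr xr'.
have h z : `|z| < rho -> 2^-1 <= 1 + z.
  by move=> /lt_le_trans/(_ r2); rewrite ltr_norml => /andP[? _]; lra.
have hz z : `|z| < rho -> 0 < 1 + z by move=> /h; lra.
have b z : `|z| < rho -> `|(1 + z)^-1| <= 2.
  move=> zr; rewrite normfV gtr0_norm ?hz// -[leRHS]invrK lef_pV2 ?posrE ?hz ?invr_gt0//.
  exact: h.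
split; first by apply: (le_trans (b x xr)); rewrite ler_nat.
have [nx nx'] : 1 + x != 0 /\ 1 + x' != 0 by split; apply: lt0r_neq0; exact: hz.
have -> : (1 + x)^-1 - (1 + x')^-1 = (1 + x)^-1 * (1 + x')^-1 * (x' - x).
  by field; rewrite nx nx'.
rewrite normrM distrC ler_wpM2r// normrM (_ : 4 = 2 * 2); last by ring.
by apply: ler_pM => //; exact: b.
Qed.

(** An asymptotic expansion of F in powers of y as y tends to 0 from above,
    uniform in x, with coefficients that depend on x. *)
Definition expansion rho F e := (forall j, lipb rho (e j)) /\
  (forall N, exists2 C, 0 <= C & forall x y, `|x| < rho -> 0 < y < rho ->
     `|F x y - \sum_(j < N) e j x * y ^+ j| <= C * y ^+ N).

Lemma expansionD rho F G e d : expansion rho F e -> expansion rho G d ->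
  expansion rho (fun x y => F x y + G x y) (fun j x => e j x + d j x).
Proof.
move=> [el eF] [dl dG]; split; first by move=> j; exact: lipbD.
move=> N; have [C C0 hC] := eF N; have [D D0 hD] := dG N.
exists (C + D); first exact: addr_ge0.
move=> x y xr yr; under eq_bigr do rewrite mulrDl.
rewrite big_split opprD addrACA mulrDl.
by apply: (le_trans (ler_normD _ _)); apply: lerD; [exact: hC|exact: hD].
Qed.

Lemma expansionZ rho g F e : lipb rho g -> expansion rho F e ->
  expansion rho (fun x y => g x * F x y) (fun j x => g x * e j x).
Proof.
move=> lg [el eF]; split; first by move=> j; exact: lipbM.
move=> N; have [C C0 hC] := eF N; have [L L0 gL] := lg.
exists (L * C); first exact: mulr_ge0.
move=> x y xr yr; under eq_bigr do rewrite -mulrA.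
rewrite -mulr_sumr -mulrBr normrM -mulrA; apply: ler_pM => //; last exact: hC.
by have [] := gL x x xr xr.
Qed.

Lemma expansion_shift rho F e : rho <= 1 -> expansion rho F e ->
  expansion rho (fun x y => y * F x y) (fun j x => if j is j'.+1 then e j' x else 0).
Proof.
move=> r1 [el eF]; split; first by move=> [|j] //; exact: lipb_cst.
move=> [|N].
  have [C C0 hC] := eF 0; exists C => // x y xr yr; have := hC x y xr yr.
  rewrite !big_ord0 !subr0 expr0 mulr1 => h; rewrite normrM -[leRHS]mul1r ler_pM//.
  by move: yr => /andP[y0 yr]; rewrite gtr0_norm//; lra.
have [C C0 hC] := eF N; exists C => // x y xr yr.
rewrite big_ord_recl mul0r add0r.
rewrite (eq_bigr (fun j : 'I_N => y * (e j x * y ^+ j))); last first.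
  by move=> j _; rewrite /bump /= ?add1n exprS; ring.
move: (yr) => /andP[y0 _].
rewrite -mulr_sumr -mulrBr normrM (gtr0_norm y0) exprS mulrCA ler_pM2l//.
exact: hC.
Qed.

(** The remainder of the product is the sum of the e_i y^i times the remainder of
    order N - i of G, plus the remainder of order N of F times G. *)
Lemma expansionM rho F G e d : expansion rho F e -> expansion rho G d ->
  expansion rho (fun x y => F x y * G x y)
    (fun n x => \sum_(i < n.+1) e i x * d (n - i)%N x).
Proof.
move=> [el eF] [dl dG]; split.
  by move=> j; apply: lipb_sum => i; exact: lipbM.
move=> N.
have [L /= hL] : {L : nat -> R & forall i, 0 <= L i /\ forall x, `|x| < rho -> `|e i x| <= L i}.
  apply: (@choice _ _ (fun i l => 0 <= l /\ forall x, `|x| < rho -> `|e i x| <= l)) => i.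
  by have [l l0 hl] := el i; exists l; split => // x xr; have [] := hl x x xr xr.
have [D /= hD] : {D : nat -> R & forall N, 0 <= D N /\ forall x y, `|x| < rho -> 0 < y < rho ->
     `|G x y - \sum_(j < N) d j x * y ^+ j| <= D N * y ^+ N}.
  apply: (@choice _ _ (fun N D => 0 <= D /\ forall x y, `|x| < rho -> 0 < y < rho ->
     `|G x y - \sum_(j < N) d j x * y ^+ j| <= D * y ^+ N)) => M.
  by have [D D0 hD] := dG M; exists D.
have [C C0 hC] := eF N.
exists (\sum_(i < N) L i * D (N - i)%N + C * D 0).
  by rewrite addr_ge0// ?mulr_ge0 ?(hD 0).1// sumr_ge0// => i _; rewrite mulr_ge0 ?(hL i).1 ?(hD _).1.
move=> x y xr yr; move: (yr) => /andP[y0 _].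
have -> : F x y * G x y - \sum_(n < N) (\sum_(i < n.+1) e i x * d (n - i)%N x) * y ^+ n =
   \sum_(i < N) e i x * y ^+ i * (G x y - \sum_(j < N - i) d j x * y ^+ j) +
   (F x y - \sum_(i < N) e i x * y ^+ i) * G x y.
  have -> : \sum_(n < N) (\sum_(i < n.+1) e i x * d (n - i)%N x) * y ^+ n =
     \sum_(i < N) e i x * y ^+ i * (\sum_(j < N - i) d j x * y ^+ j).
    transitivity (\sum_(n < N) \sum_(i < n.+1) (e i x * y ^+ i) * (d (n - i)%N x * y ^+ (n - i))).
      apply: eq_bigr => n _; rewrite mulr_suml; apply: eq_bigr => i _.
      have ni : (i <= n)%N by rewrite -ltnS.
      have -> : y ^+ n = y ^+ i * y ^+ (n - i) by rewrite -exprD subnKC.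
      by ring.
    rewrite (triangle_sum (fun i j => (e i x * y ^+ i) * (d j x * y ^+ j))).
    by apply: eq_bigr => i _; rewrite mulr_sumr.
  under [in RHS]eq_bigr do rewrite mulrBr.
  by rewrite sumrB mulrBl -mulr_suml; ring.
apply: (le_trans (ler_normD _ _)); rewrite [leRHS]mulrDl; apply: lerD.
  rewrite [leRHS]mulr_suml; apply: (le_trans (ler_norm_sum _ _ _)); apply: ler_sum => i _.
  have iN : (i <= N)%N by exact: ltnW.
  rewrite !normrM normrX (gtr0_norm y0) (_ : y ^+ N = y ^+ i * y ^+ (N - i)); last by rewrite -exprD subnKC.
  rewrite [leRHS](_ : _ = (L i * y ^+ i) * (D (N - i)%N * y ^+ (N - i))); last by ring.
  apply: ler_pM => //; first by rewrite mulr_ge0// exprn_ge0// ltW.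
    by rewrite ler_wpM2r ?exprn_ge0 ?(ltW y0)// (hL i).2.
  exact: (hD _).2.
rewrite normrM mulrAC; apply: ler_pM => //; first exact: hC.
by have := (hD 0).2 x y xr yr; rewrite big_ord0 subr0 expr0 mulr1.
Qed.

Lemma psum_expansion a r (f : R * R -> R) K q rho :
  is_psum a r f -> 1 <= K -> 1 <= q -> (forall i j, `|a i j| <= K * q ^+ (i + j)) ->
  0 < rho -> rho < r -> 8 * q * rho <= 1 ->
  exists2 e, expansion rho (fun x y => f (x, y)) e & forall j, e j 0 = a 0%N j.
Proof.
move=> af K1 q1 aK r0 rr qr.
have q0 : 0 <= q by lra.
have K0 : 0 <= K by lra.
have h2 : 0 <= 2^-1 :> R by rewrite invr_ge0.
have rle : 2 * (q * rho) <= 2^-1 by lra.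
have qr0 : 0 <= q * rho by rewrite mulr_ge0// ltW.
have term i j x : `|x| <= rho -> `|a i j * x ^+ i| <= K * q ^+ j * 2^-1 ^+ i.
  move=> xr; rewrite normrM normrX.
  apply: (@le_trans _ _ (K * q ^+ (i + j) * rho ^+ i)).
    by apply: ler_pM; rewrite ?exprn_ge0// lerXn2r ?nnegrE// ltW.
  rewrite exprD [leLHS](_ : _ = K * q ^+ j * (q * rho) ^+ i); last by rewrite exprMn; ring.
  rewrite ler_wpM2l ?mulr_ge0 ?exprn_ge0// lerXn2r ?nnegrE//; lra.
pose S j x n := \sum_(i < n) a i j * x ^+ i.
have cS j x : `|x| <= rho -> cvgn (S j x).
  move=> xr.
  have -> : S j x = series (fun i => a i j * x ^+ i).
    by apply/funext => n; rewrite /S /series /= big_mkord.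
  apply: normed_cvg; apply: nondecreasing_is_cvgn.
    apply/nondecreasing_seqP => n; rewrite /= /series /= !big_mkord big_ord_recr /=.
    by rewrite lerDl.
  exists (K * q ^+ j * 2) => _ [n _ <-]; rewrite /= /series /= big_mkord.
  apply: (@le_trans _ _ (\sum_(i < n) K * q ^+ j * 2^-1 ^+ i)).
    by apply: ler_sum => i _; exact: term.
  by rewrite -mulr_sumr ler_wpM2l ?mulr_ge0 ?exprn_ge0// sum_geo2.
pose e j x := limn (S j x).
have ce j x : `|x| <= rho -> S j x @ \oo --> e j x by move=> /(cS j).
exists e; last first.
  move=> j; apply/cvg_lim => //; apply: cvg_near_cst; near=> n.
  have n0 : (0 < n)%N by near: n; exists 1%N.
  rewrite /S -(prednK n0) big_ord_recl big1 ?addr0 ?expr0 ?mulr1// => i _.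
  by rewrite /bump /= ?add1n exprS mul0r mulr0.
split.
  move=> j; exists (K * q ^+ j * 2 + 4 * K * q ^+ j / rho).
    by rewrite addr_ge0 ?mulr_ge0 ?invr_ge0 ?exprn_ge0 // ltW.
  move=> x x' /ltW xr /ltW xr'.
  have p1 : 0 <= K * q ^+ j * 2 by rewrite !mulr_ge0 ?exprn_ge0.
  have p2 : 0 <= 4 * K * q ^+ j / rho by rewrite !mulr_ge0 ?exprn_ge0 ?invr_ge0// ltW.
  split.
    apply: (cvgn_le (cvg_norm (ce j x xr))) => n /=.
    apply: (le_trans (ler_norm_sum _ _ _)).
    apply: (@le_trans _ _ (\sum_(i < n) K * q ^+ j * 2^-1 ^+ i)).
      by apply: ler_sum => i _; exact: term.
    rewrite -mulr_sumr; apply: (@le_trans _ _ (K * q ^+ j * 2)); last by rewrite lerDl.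
    by rewrite ler_wpM2l ?mulr_ge0 ?exprn_ge0// sum_geo2.
  apply: (@le_trans _ _ (4 * K * q ^+ j / rho * `|x - x'|)); last first.
    by rewrite ler_wpM2r// lerDr.
  apply: (cvgn_le (cvg_norm (cvgB (ce j x xr) (ce j x' xr')))) => n /=.
  rewrite ?fctE /S -sumrB mulrAC ler_pdivlMr//.
  apply: (le_trans (ler_wpM2r (ltW r0) (ler_norm_sum _ _ _))); rewrite mulr_suml.
  apply: (@le_trans _ _ (\sum_(i < n) (K * q ^+ j * `|x - x'| * 2) * 2^-1 ^+ i)); last first.
    rewrite -mulr_sumr [leRHS](_ : _ = K * q ^+ j * `|x - x'| * 2 * 2); last by ring.
    by rewrite ler_wpM2l ?mulr_ge0 ?exprn_ge0// sum_geo2.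
  apply: ler_sum => i _; rewrite -mulrBr normrM -mulrA.
  have M := monomial_lip i (ltW r0) xr xr' (lexx _).
  apply: (@le_trans _ _ (K * q ^+ (i + j) * (2 ^+ i * rho ^+ i * `|x - x'|))).
    apply: ler_pM => //; first by rewrite mulr_ge0// ltW.
    by apply: (le_trans M); rewrite !ler_wpM2r ?exprn_ge0 ?(ltW r0)// natr_le_expr2.
  rewrite exprD [leLHS](_ : _ = K * q ^+ j * `|x - x'| * (2 * (q * rho)) ^+ i); last first.
    by rewrite !exprMn; ring.
  rewrite -[leRHS]mulrA ler_wpM2l ?mulr_ge0 ?exprn_ge0//.
  apply: (@le_trans _ _ (2^-1 ^+ i)).
    by rewrite lerXn2r ?nnegrE ?mulr_ge0// ltW.
  by rewrite ler_peMl ?exprn_ge0// ler1n.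
move=> N; exists (4 * (K * (2 * q) ^+ N)).
  by rewrite !mulr_ge0 ?exprn_ge0 ?mulr_ge0.
move=> x y xr /andP[y0 yr].
have pr : `|(x, y)| < r.
  have -> : `|(x, y)| = Num.max `|x| `|y| by [].
  rewrite gt_max (lt_trans xr rr) gtr0_norm//=; exact: lt_trans yr rr.
have [_ cf] := af (x, y) pr.
have cs : (fun n => \sum_(j < N) S j x n * y ^+ j) @ \oo --> \sum_(j < N) e j x * y ^+ j.
  elim: N => [|N IH].
    by under eq_fun do rewrite big_ord0; rewrite big_ord0; exact: cvg_cst.
  rewrite big_ord_recr; under eq_fun do rewrite big_ord_recr.
  by apply: cvgD => //; apply: cvgM; [exact/ce/ltW|exact: cvg_cst].
have cv : (fun n => `|\sum_(i < n) \sum_(j < n) a i j * x ^+ i * y ^+ j -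
    \sum_(j < N) S j x n * y ^+ j|) @ \oo --> `|f (x, y) - \sum_(j < N) e j x * y ^+ j|.
  exact: (cvg_norm (cvgB cf cs)).
rewrite -(cvg_shiftn N) in cv.
apply: (cvgn_le cv) => m /=; set n := (m + N)%N.
have c0 : 0 <= K * (2 * q) ^+ N * y ^+ N.
  by rewrite !mulr_ge0 ?exprn_ge0 ?mulr_ge0// ltW.
rewrite -!mulrA [X in 4 * X]mulrA.
apply: le_trans (double_geo2 n c0).
have -> : \sum_(j < N) S j x n * y ^+ j = \sum_(i < n) \sum_(j < N) a i j * x ^+ i * y ^+ j.
  rewrite exchange_big /=; apply: eq_bigr => j _.
  by rewrite /S mulr_suml.
rewrite -sumrB; apply: (le_trans (ler_norm_sum _ _ _)); apply: ler_sum => i _.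
have Nn : (N <= n)%N by rewrite leq_addl.
rewrite (@big_ord_widen _ _ _ N n (fun j => a i j * x ^+ i * y ^+ j))//.
rewrite (bigID (fun j : 'I_n => (j < N)%N)) /= addrAC subrr add0r.
apply: (le_trans (ler_norm_sum _ _ _)).
rewrite [leRHS](bigID (fun j : 'I_n => (j < N)%N)) /= -[leLHS]add0r; apply: lerD.
  by apply: sumr_ge0 => j _; rewrite mulr_ge0// exprn_ge0.
apply: ler_sum => j; rewrite -leqNgt => Nj.
rewrite normrM normrX (gtr0_norm y0).
apply: (@le_trans _ _ (K * q ^+ j * 2^-1 ^+ i * y ^+ j)).
  by rewrite ler_wpM2r ?exprn_ge0 ?(ltW y0)//; apply: term; rewrite ltW.
have -> : y ^+ j = y ^+ N * y ^+ (j - N) by rewrite -exprD subnKC.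
have -> : q ^+ j = q ^+ N * q ^+ (j - N) by rewrite -exprD subnKC.
rewrite [leLHS](_ : _ = K * (q ^+ N * y ^+ N * 2^-1 ^+ i) * (q * y) ^+ (j - N)); last first.
  by rewrite exprMn; ring.
rewrite [leRHS](_ : _ = K * (q ^+ N * y ^+ N * 2^-1 ^+ i) * 2^-1 ^+ (j - N)); last first.
  rewrite exprD (_ : 2^-1 ^+ j = 2^-1 ^+ N * 2^-1 ^+ (j - N)); last by rewrite -exprD subnKC.
  have e1 : 2 ^+ N * 2^-1 ^+ N = 1 :> R by rewrite -exprMn divff// expr1n.
  rewrite exprMn.
  transitivity ((2 ^+ N * 2^-1 ^+ N) * (K * (q ^+ N * y ^+ N * 2^-1 ^+ i) * 2^-1 ^+ (j - N))).
    by ring.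
  by rewrite e1 mul1r.
rewrite ler_wpM2l ?mulr_ge0 ?exprn_ge0 ?(ltW y0)//.
rewrite lerXn2r ?nnegrE ?mulr_ge0 ?(ltW y0)//.
have : q * y <= q * rho by rewrite ler_wpM2l// ltW.
lra.
Unshelve. all: by end_near. Qed.

(** If the coefficients before e_j vanish then F / y^j = e_j + O(y), so that e_j is
    O(y) at the zeros of F, and these accumulate everywhere on the line y = 0. *)
Lemma zeros_kill_expansion rho F e : expansion rho F e ->
  (forall x0 eps, `|x0| < rho -> 0 < eps ->
    exists x y, [/\ `|x - x0| < eps, 0 < y, y < eps & F x y = 0]) ->
  forall j x, `|x| < rho -> e j x = 0.
Proof.
move=> [el eF] z j; elim/ltn_ind: j => j IH x0 x0r.
have [C C0 hC] := eF j.+1.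
have [L L0 hL] := el j.
apply/eqP; rewrite -normr_eq0; apply/eqP/le_anti; rewrite normr_ge0 andbT.
apply/ler_addgt0Pr => eps e0; rewrite add0r.
have r0 : 0 < rho by exact: le_lt_trans (normr_ge0 _) x0r.
pose d := Num.min (rho - `|x0|) (Num.min rho (eps / (L + C + 1))).
have LC : 0 < L + C + 1 by rewrite ltr_wpDl// addr_ge0.
have d0 : 0 < d by rewrite !lt_min subr_gt0 x0r r0 divr_gt0.
have [x [y [xx0 y0 yd Fz]]] := z x0 d x0r d0.
move: (xx0) (yd); rewrite !lt_min => /and3P[x1 x2 x3] /and3P[y1 y2 y3].
have xr : `|x| < rho.
  by rewrite -(subrK x0 x) (le_lt_trans (ler_normD _ _))// -ltrBrDr.
have := hC x y xr; rewrite y0 y2 => /(_ isT).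
rewrite Fz sub0r normrN big_ord_recr big1 /= => [|i _]; last by rewrite IH ?mul0r.
rewrite add0r normrM normrX (gtr0_norm y0) exprS mulrA ler_pM2r ?exprn_gt0// => h.
have [_ h'] := hL x0 x x0r xr.
have -> : e j x0 = e j x + (e j x0 - e j x) by rewrite addrC subrK.
apply: (le_trans (ler_normD _ _)); apply: (le_trans (lerD h h')).
rewrite distrC.
have h1 : C * y <= C * (eps / (L + C + 1)) by rewrite ler_wpM2l// ltW.
have h2 : L * `|x - x0| <= L * (eps / (L + C + 1)) by rewrite ler_wpM2l// ltW.
apply: (le_trans (lerD h1 h2)).
rewrite -mulrDl mulrCA ger_pMr// ler_pdivrMr// mul1r; lra.
Qed.

Lemma sum_growth (A : R) (b : nat -> R) : 0 <= A ->
  (forall n, b n <= A + A * \sum_(i < n) b i) -> forall n, b n <= A * (1 + A) ^+ n.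
Proof.
move=> A0 h.
have hs n : A * \sum_(i < n) b i <= A * ((1 + A) ^+ n - 1).
  elim: n => [|n IH]; first by rewrite big_ord0 expr0 subrr.
  rewrite big_ord_recr mulrDr exprS /=.
  have h1 := ler_wpM2l A0 (h n); have h2 := ler_wpM2l A0 IH.
  move: IH h1 h2; set s := \sum_(i < n) _; set q := _ ^+ n; set bn := b n.
  by move=> IH h1 h2; lra.
move=> n; apply: (le_trans (h n)).
by have := hs n; lra.
Qed.

End Expansions.

(** * Curves that follow a small perturbation of the shear field *)

Section Flow.
Context {R : realType}.
Implicit Types (s t u x y eta rho : R) (z w : R * R).

Lemma cvg_pair_fst (T : Type) (F : set_system T) {FF : Filter F} (h : T -> R * R) z :
  h @ F --> z -> (fun i => (h i).1) @ F --> z.1.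
Proof.
move=> /cvgrPdist_lt hz; apply/cvgrPdist_lt => e e0; near=> x.
have : `|z - h x| < e by near: x; exact: hz.
by apply: le_lt_trans; exact: (norm_fst_le (z - h x)).
Unshelve. all: by end_near. Qed.

Lemma cvg_pair_snd (T : Type) (F : set_system T) {FF : Filter F} (h : T -> R * R) z :
  h @ F --> z -> (fun i => (h i).2) @ F --> z.2.
Proof.
move=> /cvgrPdist_lt hz; apply/cvgrPdist_lt => e e0; near=> x.
have : `|z - h x| < e by near: x; exact: hz.
by apply: le_lt_trans; exact: (norm_snd_le (z - h x)).
Unshelve. all: by end_near. Qed.

Lemma is_derive_fst (gamma : R -> R * R) s w :
  is_derive s 1 gamma w -> is_derive s 1 (fun s => (gamma s).1) w.1.
Proof.
move=> [d e].
have h : (fun h : R => h^-1 *: (gamma (h *: 1 + s) - gamma s)) @ 0^' --> w.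
  by rewrite -e; exact: d.
have c : (fun h : R => (h^-1 *: ((gamma (h *: 1 + s)).1 - (gamma s).1) : R)) @ 0^' --> w.1.
  exact: (cvg_pair_fst h).
by split; [exact: cvgP c|exact: cvg_lim c].
Qed.

Lemma is_derive_snd (gamma : R -> R * R) s w :
  is_derive s 1 gamma w -> is_derive s 1 (fun s => (gamma s).2) w.2.
Proof.
move=> [d e].
have h : (fun h : R => h^-1 *: (gamma (h *: 1 + s) - gamma s)) @ 0^' --> w.
  by rewrite -e; exact: d.
have c : (fun h : R => (h^-1 *: ((gamma (h *: 1 + s)).2 - (gamma s).2) : R)) @ 0^' --> w.2.
  exact: (cvg_pair_snd h).
by split; [exact: cvgP c|exact: cvg_lim c].
Qed.

Lemma norm_pair_le z u : (`|z| <= u) = (`|z.1| <= u) && (`|z.2| <= u).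
Proof. by have -> : `|z| = Num.max `|z.1| `|z.2| by []; rewrite ge_max. Qed.

Lemma norm_pair_lt z u : (`|z| < u) = (`|z.1| < u) && (`|z.2| < u).
Proof. by have -> : `|z| = Num.max `|z.1| `|z.2| by []; rewrite gt_max. Qed.

Variables (f g : R * R -> R) (gamma : R -> R * R) (rho : R).
Let eta : R := 30^-1.
Hypotheses (rho0 : 0 < rho) (f0 : f 0 = 0) (g0 : g 0 = 0).
Hypothesis fl : forall z w, `|z| <= rho -> `|w| <= rho -> `|f z - f w| <= eta * `|z - w|.
Hypothesis gl : forall z w, `|z| <= rho -> `|w| <= rho -> `|g z - g w| <= eta * `|z - w|.
Hypothesis dgamma : forall s, 0 <= s <= 1 ->
  is_derive s 1 gamma ((gamma s).2 + f (gamma s), g (gamma s)).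
Hypothesis gamma_start : `|gamma 0| < rho / 8.

Let u s := (gamma s).1.
Let v s := (gamma s).2.
Let w1 s := v s + f (gamma s).
Let w2 s := g (gamma s).

Let du s : 0 <= s <= 1 -> is_derive s 1 u (w1 s).
Proof. by move=> /dgamma /is_derive_fst. Qed.

Let dv s : 0 <= s <= 1 -> is_derive s 1 v (w2 s).
Proof. by move=> /dgamma /is_derive_snd. Qed.

Let cgamma s : 0 <= s <= 1 -> {for s, continuous gamma}.
Proof.
by move=> /dgamma [d _]; apply/differentiable_continuous/derivable1_diffP.
Qed.

Let f_small z : `|z| <= rho -> `|f z| <= eta * rho.
Proof.
move=> zr; rewrite -[f z]subr0 -f0; apply: (le_trans (fl zr _)).
  by rewrite normr0 ltW.
by rewrite subr0 ler_wpM2l// invr_ge0.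
Qed.

Let g_small z : `|z| <= rho -> `|g z| <= eta * rho.
Proof.
move=> zr; rewrite -[g z]subr0 -g0; apply: (le_trans (gl zr _)).
  by rewrite normr0 ltW.
by rewrite subr0 ler_wpM2l// invr_ge0.
Qed.

Let rho_num : eta * rho * 1 + rho / 8 <= rho / 4 /\
  (rho / 4 + eta * rho) * 1 + rho / 8 <= rho / 2.
Proof. by have r0 := rho0; rewrite /eta; split; lra. Qed.

(** At the first exit time the second component would have moved by at most
    rho / 30, as its speed is g; then the speed of the first component was at
    most rho / 4 + rho / 30, which is not enough to reach the boundary. *)
Lemma flow_confined s : 0 <= s <= 1 -> `|gamma s| < rho.
Proof.
have r0 := rho0; move=> s01; rewrite ltNge; apply/negP => rs.
(* The infimum m of A is the first exit time. *)
pose A := [set s : R | 0 <= s <= 1 /\ rho <= `|gamma s|].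
have As : A s by [].
have Alb : lbound A 0 by move=> x [/andP[]].
have hA : has_inf A by split; [exists s|exists 0].
pose m := inf A.
have m0 : 0 <= m by apply: lb_le_inf => //; exists s.
have mA x : A x -> m <= x by move=> Ax; apply: ge_inf => //; exists 0.
have m1 : m <= 1 by apply: (le_trans (mA s As)); case/andP: s01.
have below (c : R) : 0 <= c < m -> `|gamma c| <= rho.
  move=> /andP[c0 cm]; rewrite leNgt; apply/negP => rc.
  have /mA : A c by split; [rewrite c0 (ltW (lt_le_trans cm m1))|exact: ltW].
  by rewrite leNgt cm.
have st := gamma_start.
rewrite norm_pair_lt in st; move/andP: st => [st1 st2].
have vm (k : R) : 0 <= k <= m -> `|v k| <= rho / 4.
  move=> /andP[]; rewrite le_eqVlt => /predU1P[<- _|k0 km].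
    by apply/ltW/(lt_le_trans st2); rewrite ler_pM2l// lef_pV2 ?posrE// ler_nat.
  have [c /andP[c0 ck] E] : exists2 c, 0 < c < k & v k - v 0 = w2 c * (k - 0).
    apply: mvt_ex => // x /andP[x0 xk]; apply: dv.
    by rewrite x0 (le_trans xk)// (le_trans km).
  have gc : `|w2 c| <= eta * rho.
    by apply/g_small/below; rewrite ltW//= (lt_le_trans ck).
  rewrite -[v k](subrK (v 0)) E subr0.
  apply: (le_trans (ler_normD _ _)); rewrite normrM (gtr0_norm k0).
  have Q : `|w2 c| * k <= eta * rho * 1.
    by apply: ler_pM => //; [exact: ltW|exact: le_trans km m1].
  by apply: (le_trans (lerD Q (ltW st2))); exact: rho_num.1.
have um : `|u m| <= rho / 2.
  move: m0; rewrite le_eqVlt => /predU1P[<-|w0].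
    by apply/ltW/(lt_le_trans st1); rewrite ler_pM2l// lef_pV2 ?posrE// ler_nat.
  have [c /andP[c0 cw] E] : exists2 c, 0 < c < m & u m - u 0 = w1 c * (m - 0).
    apply: mvt_ex => // x /andP[x0 xw]; apply: du.
    by rewrite x0 (le_trans xw).
  have gc : `|w1 c| <= rho / 4 + eta * rho.
    apply: (le_trans (ler_normD _ _)); apply: lerD; first by apply: vm; rewrite !ltW.
    by apply/f_small/below; rewrite ltW.
  rewrite -[u m](subrK (u 0)) E subr0.
  apply: (le_trans (ler_normD _ _)); rewrite normrM (gtr0_norm w0).
  have Q : `|w1 c| * m <= (rho / 4 + eta * rho) * 1.
    by apply: ler_pM => //; exact: ltW.
  by apply: (le_trans (lerD Q (ltW st1))); exact: rho_num.2.
have gm : `|gamma m| < rho.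
  rewrite norm_pair_lt; apply/andP; split; first by apply: (le_lt_trans um); lra.
  by apply: (le_lt_trans (vm m _)); [rewrite m0 lexx|lra].
have m01 : 0 <= m <= 1 by rewrite m0.
have e0 : 0 < rho - `|gamma m| by rewrite subr_gt0.
have := cgamma m01 => /cvgrPdist_lt /(_ _ e0).
rewrite near_simpl => /nbhs_ballP[del /= del0 hd].
have [x Ax xm] := inf_adherent del0 hA.
have mx := mA x Ax.
have : `|gamma m - gamma x| < rho - `|gamma m|.
  by apply: hd; rewrite /ball /= ler0_norm ?subr_le0// opprB ltrBlDl.
move: Ax => [_ rx].
have := ler_distD (gamma m) (gamma x) 0; rewrite !subr0 distrC => h1 h2.
by lra.
Qed.

Let oscillation_le (F F' : R -> R) B : (forall s, 0 <= s <= 1 -> is_derive s 1 F (F' s)) ->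
  (forall s, 0 <= s <= 1 -> `|F' s| <= B) ->
  forall s s', 0 <= s <= 1 -> 0 <= s' <= 1 -> `|F s - F s'| <= B.
Proof.
move=> dF FB.
have B0 : 0 <= B by apply: le_trans (FB 0 _) => //; rewrite lexx ler01.
suff H s s' : s' <= s -> 0 <= s <= 1 -> 0 <= s' <= 1 -> `|F s - F s'| <= B.
  move=> s s' hs hs'; have [/H|/ltW/H] := leP s' s; first exact.
  by rewrite distrC; exact.
move=> ss /andP[s0 s1] /andP[s'0 s'1].
have h x : s' <= x <= s -> 0 <= x <= 1.
  by move=> /andP[a b]; rewrite (le_trans s'0)//= (le_trans b).
apply: (@le_trans _ _ (B * (s - s'))).
  by apply: (@mvt_le _ F F') => // x /h; [exact: dF|exact: FB].
by rewrite ler_piMr//; lra.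
Qed.

Let continuous_w1 s : 0 <= s <= 1 -> {for s, continuous w1}.
Proof.
move=> s01; apply: cvgD.
  by apply/differentiable_continuous/derivable1_diffP; have [] := dv s01.
apply/cvgrPdist_le => e e0.
have := cgamma s01 => /cvgrPdist_lt hg.
have r1 : 0 < rho - `|gamma s| by rewrite subr_gt0 flow_confined.
near=> x.
have h1 : `|gamma s - gamma x| < rho - `|gamma s| by near: x; exact: hg.
have h2 : `|gamma s - gamma x| < e by near: x; exact: hg.
have gx : `|gamma x| <= rho.
  by rewrite -(subrK (gamma s) (gamma x)) (le_trans (ler_normD _ _))// distrC -lerBrDr ltW.
apply: (le_trans (fl _ gx)); first exact/ltW/flow_confined.
apply: (@le_trans _ _ (1 * `|gamma s - gamma x|)); last by rewrite mul1r ltW.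
by rewrite ler_wpM2r// /eta invf_le1// ler1n.
Unshelve. all: by end_near. Qed.

Let continuous_w2 s : 0 <= s <= 1 -> {for s, continuous w2}.
Proof.
move=> s01; apply/cvgrPdist_le => e e0.
have := cgamma s01 => /cvgrPdist_lt hg.
have r1 : 0 < rho - `|gamma s| by rewrite subr_gt0 flow_confined.
near=> x.
have h1 : `|gamma s - gamma x| < rho - `|gamma s| by near: x; exact: hg.
have h2 : `|gamma s - gamma x| < e by near: x; exact: hg.
have gx : `|gamma x| <= rho.
  by rewrite -(subrK (gamma s) (gamma x)) (le_trans (ler_normD _ _))// distrC -lerBrDr ltW.
apply: (le_trans (gl _ gx)); first exact/ltW/flow_confined.
apply: (@le_trans _ _ (1 * `|gamma s - gamma x|)); last by rewrite mul1r ltW.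
by rewrite ler_wpM2r// /eta invf_le1// ler1n.
Unshelve. all: by end_near. Qed.

Let max_exists (F : R -> R) : (forall s, 0 <= s <= 1 -> {for s, continuous F}) ->
  exists2 m, 0 <= m <= 1 & forall s, 0 <= s <= 1 -> `|F s| <= `|F m|.
Proof.
move=> cF.
have cN : {within `[0, 1], continuous (fun s => `|F s|)}.
  apply: continuous_in_subspaceT => x; rewrite inE /= in_itv /= => x01.
  exact: cvg_norm (cF x x01).
have [m m01 h] := EVT_max ler01 cN.
exists m; first by move: m01; rewrite in_itv.
by move=> s s01; apply: h; rewrite in_itv.
Qed.

(** Let M1 and M2 be the maximal speeds of the two components. At some instant each
    speed equals the displacement over unit time, and the Lipschitz bounds
    control its oscillation: M1 <= D1 + M2 + (M1 + M2) / 30 and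
    M2 <= D2 + (M1 + M2) / 30. These inequalities bound M1 and M2 by D1 and D2. *)
Lemma flow_displacement :
  let D1 := `|u 1 - u 0| in let D2 := `|v 1 - v 0| in
  forall s, 0 <= s <= 1 ->
    `|u s - u 0| <= 2 * D1 + 4 * D2 /\ `|v s - v 0| <= 20^-1 * D1 + 2 * D2.
Proof.
move=> D1 D2.
have [m1 m1i h1] := max_exists continuous_w1.
have [m2 m2i h2] := max_exists continuous_w2.
set M1 := `|w1 m1| in h1; set M2 := `|w2 m2| in h2.
have Mu := oscillation_le du h1.
have Mv := oscillation_le dv h2.
have [c1 /andP[c10 c11] E1] := mvt_ex ltr01 du.
have [c2 /andP[c20 c21] E2] := mvt_ex ltr01 dv.
rewrite subr0 mulr1 in E1; rewrite subr0 mulr1 in E2.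
have c1i : 0 <= c1 <= 1 by rewrite !ltW.
have c2i : 0 <= c2 <= 1 by rewrite !ltW.
have M10 : 0 <= M1 by exact: normr_ge0.
have M20 : 0 <= M2 by exact: normr_ge0.
have dg s s' : 0 <= s <= 1 -> 0 <= s' <= 1 -> `|gamma s - gamma s'| <= M1 + M2.
  move=> si si'; rewrite norm_pair_le; apply/andP; split.
    by apply: (le_trans (Mu _ _ si si')); rewrite lerDl.
  by apply: (le_trans (Mv _ _ si si')); rewrite lerDr.
have A1 : M1 <= D1 + M2 + eta * (M1 + M2).
  have T := ler_normD (w1 m1 - w1 c1) (w1 c1).
  rewrite subrK in T; apply: (le_trans T).
  have -> : `|w1 c1| = D1 by rewrite -E1.
  rewrite [leLHS]addrC -[leRHS]addrA lerD2l /w1 opprD addrACA.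
  apply: (le_trans (ler_normD _ _)); apply: lerD; first exact: Mv.
  apply: (le_trans (fl _ _)); try exact/ltW/flow_confined.
  by apply: ler_wpM2l; [rewrite invr_ge0|exact: dg].
have A2 : M2 <= D2 + eta * (M1 + M2).
  have T := ler_normD (w2 m2 - w2 c2) (w2 c2).
  rewrite subrK in T; apply: (le_trans T).
  have -> : `|w2 c2| = D2 by rewrite -E2.
  rewrite [leLHS]addrC lerD2l /w2.
  apply: (le_trans (gl _ _)); try exact/ltW/flow_confined.
  by apply: ler_wpM2l; [rewrite invr_ge0|exact: dg].
have D10 : 0 <= D1 by exact: normr_ge0.
have D20 : 0 <= D2 by exact: normr_ge0.
move=> s si; have z0 : 0 <= (0 : R) <= 1 by rewrite lexx ler01.
have := Mu s 0 si z0; have := Mv s 0 si z0.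
move: A1 A2; rewrite /eta => A1 A2 B1 B2; split; lra.
Qed.

End Flow.

(** * The rational map and its first integral *)

Section Transformation.
Context {R : realType}.
Implicit Types (s t u x y c : R) (p z w : R * R).

(** The inverse of [slope] is a time coordinate for the shear: it increases by 1
    at each step. *)
Definition slope p : R := p.2 / (1 + p.1).
Definition yfrac c p : R := p.2 / (1 + p.1 + c * p.2).
Definition shift_amount t : R := t ^+ 2 / (1 + t / 2).

(** The map of [phi_slopeE], with rational functions of the slope expanded in
    partial fractions whose power series are explicit. *)
Definition phi p : R * R :=
  (p.1 + p.2 + 2 * (yfrac 0 p - yfrac 2^-1 p),
   p.2 + (2 * yfrac 0 p - 4 * yfrac 2^-1 p + 2 * yfrac 1 p)).

Lemma small_denoms p : `|p| < 8^-1 ->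
  [/\ 0 < 1 + p.1, `|slope p| < 7^-1 & forall c, `|c| <= 1 -> 0 < 1 + p.1 + c * p.2].
Proof.
move=> p8; have h1 := le_lt_trans (norm_fst_le p) p8.
have h2 := le_lt_trans (norm_snd_le p) p8.
have x0 : 7 / 8 < 1 + p.1 by move: h1; rewrite ltr_norml => /andP[? _]; lra.
have x0' : 0 < 1 + p.1 by lra.
split => //.
  rewrite /slope normrM normfV (gtr0_norm x0') ltr_pdivrMr//; lra.
move=> c c1; have : `|c * p.2| <= 1 * `|p.2| by rewrite normrM ler_wpM2r.
by rewrite ler_norml => /andP[? _]; lra.
Qed.

Lemma phi_slopeE p : 0 < 1 + p.1 -> `|slope p| < 2^-1 -> let t := slope p in
  phi p = (p.1 + p.2 + shift_amount t, p.2 + t / (1 + t) * shift_amount t).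
Proof.
move=> x0 t2 /=; move: t2; rewrite /phi /yfrac /shift_amount mul0r addr0.
have n0 : 1 + p.1 != 0 by exact: lt0r_neq0.
have yE : p.2 = slope p * (1 + p.1) by rewrite /slope divfK.
rewrite ltr_norml yE; move: (slope p) n0 x0 => t n0 x0 /andP[t1 t2].
have -> : 1 + p.1 + 2^-1 * (t * (1 + p.1)) = (1 + p.1) * (1 + t / 2) by field.
have -> : 1 + p.1 + 1 * (t * (1 + p.1)) = (1 + p.1) * (1 + t) by ring.
congr (_, _); congr (_ + _); field; repeat (apply/andP; split => //);
  by apply: lt0r_neq0; lra.
Qed.

Lemma phiE p : `|p| < 8^-1 -> let t := slope p in
  phi p = (p.1 + p.2 + shift_amount t, p.2 + t / (1 + t) * shift_amount t).
Proof.
move=> /small_denoms [x0 t7 _]; apply: phi_slopeE => //.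
by apply: (lt_trans t7); rewrite ltf_pV2 ?posrE// ltr_nat.
Qed.

Lemma slope_phi p : `|p| < 8^-1 ->
  [/\ slope (phi p) = slope p / (1 + slope p), 0 < 1 + slope p & 0 < 1 + (phi p).1].
Proof.
move=> p8; have [x0 t7 xc] := small_denoms p8.
rewrite phiE//= /slope -/(slope p) /=; set t := slope p in t7 *.
have yE : p.2 = t * (1 + p.1) by rewrite /t /slope divfK// lt0r_neq0.
have t0 : 0 < 1 + t by move: t7; rewrite ltr_norml => /andP[? _]; lra.
have t2 : 0 < 1 + t / 2 by move: t7; rewrite ltr_norml => /andP[? _]; lra.
have a0 : 0 <= shift_amount t by rewrite divr_ge0 ?sqr_ge0 ?ltW.
have d0 : 0 < (1 + p.1) * (1 + t) + shift_amount t by rewrite ltr_wpDr// mulr_gt0.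
have e : 1 + (p.1 + p.2 + shift_amount t) = (1 + p.1) * (1 + t) + shift_amount t.
  by rewrite yE; ring.
split => //; last by rewrite e.
rewrite e yE; field; by rewrite !lt0r_neq0.
Qed.

(** The second component of [slide (lap 0)], the conjugacy to the shear. *)
Definition first_integral p : R := p.2 + slope p * lap 0 (slope p).

Lemma first_integral_phi p : `|p| < 8^-1 -> first_integral (phi p) = first_integral p.
Proof.
move=> p8; have [sE t0 _] := slope_phi p8; have [x0 t7 xc] := small_denoms p8.
rewrite /first_integral sE (phiE p8) /=; move: (slope p) t7 t0 => t t7 t0.
have t1 : `|t| < 1 by apply: (lt_trans t7); rewrite invf_lt1// ltr1n.
have F := lap_functional_eq t1.
have -> : lap 0 (t / (1 + t)) = (1 + t) * lap 0 t - shift_amount t.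
  by rewrite /shift_amount -F opprB [RHS]addrC subrK.
by field; exact: lt0r_neq0.
Qed.

Definition dbeta t : R := lap 0 t + t * lap 1 t.

Lemma is_derive_beta t : is_derive t 1 (fun t => t * lap 0 t) (dbeta t).
Proof.
have := is_deriveM (is_derive_id t 1) (is_derive_lap 0 t) => h.
by apply: (is_derive_eq h); rewrite /dbeta /GRing.scale /= mulr1 addrC.
Qed.

Section FlowZero.
Variables (f g : R * R -> R).

(** This is (1 + x)^2 times the derivative of [first_integral] along the field
    (y + f, g); the factor removes the denominators. *)
Definition defect x y : R :=
  (1 + x) ^+ 2 * g (x, y) - dbeta (y / (1 + x)) * (y * (y + f (x, y)) - (1 + x) * g (x, y)).

(** Rolle's theorem for [first_integral] along the curve. The displacement bounds
    keep the zero close to the starting point, and y of the order of y0. *)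
Lemma flow_defect_zero (gamma : R -> R * R) (rho x0 y0 : R) :
  0 < rho -> rho <= 8^-1 -> f 0 = 0 -> g 0 = 0 ->
  (forall z w, `|z| <= rho -> `|w| <= rho -> `|f z - f w| <= 30^-1 * `|z - w|) ->
  (forall z w, `|z| <= rho -> `|w| <= rho -> `|g z - g w| <= 30^-1 * `|z - w|) ->
  (forall s, 0 <= s <= 1 ->
    is_derive s 1 gamma ((gamma s).2 + f (gamma s), g (gamma s))) ->
  gamma 0 = (x0, y0) -> gamma 1 = phi (x0, y0) -> `|(x0, y0)| < rho / 8 ->
  0 < y0 -> y0 <= 16^-1 ->
  exists x y, [/\ `|x - x0| <= 5 * y0, 0 < y, y <= 2 * y0 & defect x y = 0].
Proof.
move=> r0 r8 f0 g0 fl gl dg g0E g1E p0r y00 y016.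
have st : `|gamma 0| < rho / 8 by rewrite g0E.
have conf := flow_confined r0 f0 g0 fl gl dg st.
have disp := flow_displacement r0 f0 g0 fl gl dg st.
have p8 : `|(x0, y0)| < 8^-1.
  by apply: (lt_le_trans p0r); apply: le_trans r8; lra.
have [/= X0 t7 _] := small_denoms p8.
have x7 : 7 / 8 < 1 + x0.
  have := le_lt_trans (norm_fst_le (x0, y0)) p8; rewrite /= ltr_norml => /andP[? _]; lra.
set t := slope (x0, y0) in t7.
have t0 : 0 < t by rewrite divr_gt0.
have t2 : t <= 8 / 7 * y0.
  have tE : t * (1 + x0) = y0 by rewrite /t /slope /= divfK// lt0r_neq0.
  by have := ler_wpM2l (ltW t0) (ltW x7); rewrite tE; lra.
(* The displacement of phi is O(y0) in x and O(y0^3) in y. *)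
have D1 : `|(gamma 1).1 - (gamma 0).1| <= 2 * y0.
  rewrite g1E g0E phiE//= -/t.
  have a0 : 0 <= shift_amount t by rewrite divr_ge0 ?sqr_ge0 ?addr_ge0 ?divr_ge0// ltW.
  have : shift_amount t <= y0.
    rewrite /shift_amount ler_pdivrMr; last by rewrite ltr_wpDr// divr_ge0// ltW.
    nra.
  by rewrite ger0_norm; lra.
have D2 : `|(gamma 1).2 - (gamma 0).2| <= 30^-1 * y0.
  rewrite g1E g0E phiE//= -/t.
  have tp : 0 < 1 + t by lra.
  have tq : 0 < 1 + t / 2 by lra.
  have a0 : 0 <= t / (1 + t) * shift_amount t.
    by rewrite mulr_ge0 ?divr_ge0 ?sqr_ge0// ltW.
  rewrite addrAC subrr add0r ger0_norm//.
  have -> : t / (1 + t) * shift_amount t = t ^+ 3 / ((1 + t) * (1 + t / 2)).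
    by rewrite /shift_amount; field; rewrite !lt0r_neq0//; lra.
  rewrite ler_pdivrMr ?mulr_gt0//.
  have : t ^+ 2 <= 160^-1 by nra.
  have : 1 <= (1 + t) * (1 + t / 2) by nra.
  rewrite exprS; nra.
pose H s := (gamma s).2 + slope (gamma s) * lap 0 (slope (gamma s)).
pose H' s := g (gamma s) + dbeta (slope (gamma s)) *
  (g (gamma s) * (1 + (gamma s).1)^-1 -
   (gamma s).2 * (1 + (gamma s).1)^-1 ^+ 2 * ((gamma s).2 + f (gamma s))).
have pos s : 0 <= s <= 1 -> 1 + (gamma s).1 != 0.
  move=> s01; have := le_lt_trans (norm_fst_le _) (conf s s01).
  by move=> /lt_le_trans/(_ r8); rewrite ltr_norml => /andP[? _]; apply: lt0r_neq0; lra.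
have dH s : 0 <= s <= 1 -> is_derive s 1 H (H' s).
  move=> s01; have d1 := is_derive_fst (dg s s01); have d2 := is_derive_snd (dg s s01).
  have d1' := is_deriveD (is_derive_cst (1 : R) s 1) d1.
  have di := @is_deriveV _ (fun s => 1 + (gamma s).1) _ _ _ (pos s s01) d1'.
  have dt : is_derive s 1 (fun s => slope (gamma s)) _ := is_deriveM d2 di.
  have db := @is_derive1_comp _ (fun t => t * lap 0 t) (fun s => slope (gamma s))
    s _ _ (is_derive_beta (slope (gamma s))) dt.
  apply: (is_derive_eq (is_deriveD d2 db)); rewrite /H' /= /GRing.scale /=.
  by rewrite exprVn; field; exact: pos.
(* H takes the same value at both ends, so its derivative vanishes in between. *)
have [k /andP[k0 k1] HE] := mvt_ex ltr01 dH.
have k01 : 0 <= k <= 1 by rewrite !ltW.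
have H'0 : H' k = 0.
  have : H 1 - H 0 = 0.
    rewrite /H g1E g0E -/(first_integral _) -/(first_integral (x0, y0)).
    by rewrite first_integral_phi// subrr.
  by rewrite HE subr0 mulr1.
have [dx dy] := disp k k01.
have dx' : `|(gamma k).1 - x0| <= 5 * y0.
  rewrite (_ : x0 = (gamma 0).1); last by rewrite g0E.
  by apply: (le_trans dx); clear -D1 D2 y00; lra.
have dy' : `|(gamma k).2 - y0| <= 2^-1 * y0.
  rewrite {1}(_ : y0 = (gamma 0).2); last by rewrite g0E.
  by apply: (le_trans dy); clear -D1 D2 y00; lra.
exists (gamma k).1, (gamma k).2; split => //.
- by clear -dy' y00; move: dy'; rewrite ler_norml => /andP[? _]; lra.
- by clear -dy' y00; move: dy'; rewrite ler_norml => /andP[_ ?]; lra.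
- rewrite /defect -surjective_pairing -/(slope (gamma k)).
  move: H'0; rewrite /H'; have := pos k k01.
  move: (dbeta _) (f _) (g _) => B F G; move: (gamma k) => z n0 h.
  transitivity ((1 + z.1) ^+ 2 * 0); last by rewrite mulr0.
  by rewrite -[X in _ = _ * X]h; field.
Qed.

End FlowZero.
End Transformation.

(** * The map does not embed in an analytic flow *)

Section NotEmbeddable.
Context {R : realType}.
Implicit Types (s t u x y K q rho : R) (i j k n m N : nat).

Definition lap_coef j : R := lap j 0 / j`!%:R.

Lemma dbeta_taylor N : exists2 C : R, 0 <= C & forall t, `|t| <= 1 ->
  `|dbeta t - \sum_(j < N) j.+1%:R * lap_coef j * t ^+ j| <= C * `|t| ^+ N.
Proof.
case: N => [|N].
  have [C hC] := @lap_bounded R 0; have [D hD] := @lap_bounded R 1.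
  have C0 : 0 <= C by exact: le_trans (normr_ge0 _) (hC 0).
  have D0 : 0 <= D by exact: le_trans (normr_ge0 _) (hD 0).
  exists (C + D); first exact: addr_ge0.
  move=> t t1; rewrite big_ord0 subr0 expr0 mulr1 /dbeta.
  apply: (le_trans (ler_normD _ _)); apply: lerD; first exact: hC.
  by rewrite normrM -[leRHS]mul1r; apply: ler_pM.
have [C hC] := @lap_taylor R N.+1 0; have [D hD] := @lap_taylor R N 1.
have C0 : 0 <= C.
  by have := le_trans (normr_ge0 _) (hC 1); rewrite normr1 expr1n mulr1.
have D0 : 0 <= D.
  by have := le_trans (normr_ge0 _) (hD 1); rewrite normr1 expr1n mulr1.
exists (C + D); first exact: addr_ge0.
move=> t t1.
have hC' := hC t; have hD' := hD t.
set S := \sum_(j < N.+1) j.+1%:R * lap_coef j * t ^+ j.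
set A := \sum_(j < N.+1) _ in hC'; set B := \sum_(j < N) _ in hD'.
have SE : S = A + t * B.
  have SA : S - A = \sum_(j < N.+1) j%:R * lap_coef j * t ^+ j.
    rewrite /S /A -sumrB; apply: eq_bigr => j _.
    by rewrite add0n -/(lap_coef j) -addn1 natrD !mulrDl mul1r addrK.
  rewrite -[S](subrK A) SA addrC; congr (_ + _).
  rewrite big_ord_recl mul0r mul0r add0r /B mulr_sumr; apply: eq_bigr => j _.
  rewrite (_ : nat_of_ord (lift ord0 j) = j.+1)// /lap_coef factS natrM exprS.
  have j1 : j`!%:R != 0 :> R by rewrite pnatr_eq0 -lt0n fact_gt0.
  move: (lap _ _) => L; field.
  by rewrite j1 /= ?andbT ?nat1r ?natr1 pnatr_eq0.
have -> : dbeta t - S = (lap 0 t - A) + t * (lap 1 t - B) by rewrite SE /dbeta; ring.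
apply: (le_trans (ler_normD _ _)); rewrite [leRHS]mulrDl; apply: lerD => //.
by rewrite normrM exprS [leRHS]mulrCA ler_wpM2l.
Qed.

Lemma dbeta_expansion rho : rho <= 2^-1 ->
  expansion rho (fun x y => dbeta (y / (1 + x)))
    (fun j x => j.+1%:R * lap_coef j * (1 + x)^-1 ^+ j).
Proof.
move=> r2; split.
  move=> j; apply: lipbM; first exact: lipb_cst.
  elim: j => [|j IH].
    by rewrite (_ : (fun _ => _) = fun=> 1); [exact: lipb_cst|apply/funext => x; rewrite expr0].
  rewrite (_ : (fun _ => _) = fun x => (1 + x)^-1 * (1 + x)^-1 ^+ j).
    by apply: lipbM => //; exact: lipb_inv.
  by apply/funext => x; rewrite exprS.
move=> N; have [C C0 hC] := dbeta_taylor N.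
exists (C * 2 ^+ N); first by rewrite mulr_ge0// exprn_ge0.
move=> x y xr /andP[y0 yr].
have x2 : 2^-1 < 1 + x.
  by move: xr => /lt_le_trans/(_ r2); rewrite ltr_norml => /andP[? _]; lra.
have x0 : 0 < 1 + x by lra.
have t2 : `|y / (1 + x)| <= 2 * y.
  rewrite normrM normfV !gtr0_norm// ler_pdivrMr//.
  by have := ler_wpM2l (ltW y0) (ltW x2); lra.
have t1 : `|y / (1 + x)| <= 1 by apply: (le_trans t2); lra.
have := hC _ t1.
rewrite (eq_bigr (fun j : 'I_N => j.+1%:R * lap_coef j * (1 + x)^-1 ^+ j * y ^+ j)); last first.
  by move=> j _; rewrite exprMn; ring.
move=> /le_trans; apply; rewrite -mulrA ler_wpM2l// -exprMn.
by rewrite lerXn2r ?nnegrE ?mulr_ge0 // ltW.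
Qed.

Lemma expansion_cst1 rho : expansion rho (fun _ _ => 1) (fun j _ => (j == 0)%:R).
Proof.
split; first by move=> j; exact: lipb_cst.
move=> [|N]; exists 1 => // x y _ /andP[y0 _].
  by rewrite big_ord0 subr0 normr1 expr0 mulr1.
rewrite big_ord_recl big1 => [|j _]; last by rewrite mul0r.
by rewrite expr0 mulr1 addr0 subrr normr0 mul1r exprn_ge0// ltW.
Qed.

Lemma lipb_add1 rho : lipb rho (fun x => 1 + x).
Proof.
exists (1 + `|rho|) => [|x x' xr xr']; first exact: addr_ge0.
split.
  apply: (le_trans (ler_normD _ _)); rewrite normr1 lerD2l.
  exact: (le_trans (ltW xr) (ler_norm _)).
by rewrite opprD addrACA subrr add0r ler_peMl// lerDl.
Qed.

(** As delta = y^2 + ..., the relation determines b_n from G_(n + 2) and the b_i with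
    i < n; after division by q^n this is a discrete Gronwall inequality. *)
Lemma quotient_coef_growth (b delta G : nat -> R) K q : 1 <= K -> 1 <= q ->
  (forall j, `|delta j| <= K * q ^+ j) -> (forall j, `|G j| <= K * q ^+ j) ->
  delta 0 = 0 -> delta 1 = 0 -> delta 2 = 1 ->
  (forall n, G n = \sum_(i < n.+1) b i * delta (n - i)%N) ->
  exists A Q, [/\ 0 <= A, 1 <= Q & forall n, `|b n| <= A * Q ^+ n].
Proof.
move=> K1 q1 dK GK d0 d1 d2 GE.
have q0 : 0 < q by lra.
have K0 : 0 < K by lra.
pose A := K * q ^+ 2.
have A0 : 0 <= A by rewrite mulr_ge0 ?exprn_ge0// ltW.
exists A, (q * (1 + A)); split => //.
  by have := mulr_ge0 (ltW q0) A0; lra.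
have bE n : b n = G n.+2 - \sum_(i < n) b i * delta (n.+2 - i)%N.
  rewrite GE 3!big_ord_recr /= subnn d0 mulr0 addr0 subSnn d1 mulr0 addr0.
  have -> : (n.+2 - n = 2)%N by lia.
  by rewrite d2 mulr1 addrAC subrr add0r.
have H n : `|b n| / q ^+ n <= A + A * \sum_(i < n) `|b i| / q ^+ i.
  rewrite ler_pdivrMr ?exprn_gt0// bE mulrDl.
  apply: (le_trans (ler_normB _ _)); apply: lerD.
    by apply: (le_trans (GK _)); rewrite /A -addn2 exprD; nra.
  apply: (le_trans (ler_norm_sum _ _ _)); rewrite mulr_sumr mulr_suml.
  apply: ler_sum => i _; rewrite normrM.
  have -> : A * (`|b i| / q ^+ i) * q ^+ n = `|b i| * (K * q ^+ (n.+2 - i)).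
    have i_n : (i <= n)%N by exact: ltnW.
    have -> : (n.+2 - i = (n - i) + 2)%N by lia.
    have -> : q ^+ n = q ^+ i * q ^+ (n - i) by rewrite -exprD subnKC.
    by rewrite exprD /A; field; rewrite expf_neq0// gt_eqF.
  by rewrite ler_wpM2l.
move=> n; have := sum_growth A0 H n.
by rewrite ler_pdivrMr ?exprn_gt0// exprMn; lra.
Qed.

Lemma lap_coef_not_geometric A Q : 0 <= A -> 1 <= Q ->
  (forall n, `|n.+1%:R * lap_coef n| <= A * Q ^+ n) -> False.
Proof.
move=> A0 Q1 h.
have Q0 : 0 < Q by lra.
have M0 : 0 <= 2 * Q by rewrite mulr_ge0// ltW.
have [c c0 hc] := lap_superexp M0.
(* At the odd index k the bound would give c 2^k <= A. *)
pose m := Num.bound (A / c).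
have mA : A < m%:R * c.
  rewrite -ltr_pdivrMr//; apply: le_lt_trans (archi_boundP _) => //.
  by rewrite divr_ge0// ltW.
set k := m.*2.+1.
have := hc m; rewrite -/k -/(lap_coef k) => h1.
have h2 : `|lap_coef k| <= `|k.+1%:R * lap_coef k|.
  by rewrite [leRHS]normrM [X in _ <= X * _]ger0_norm// ler_peMl// ler1n.
have := le_trans h1 (le_trans h2 (h k)).
rewrite exprMn mulrA ler_pM2r ?exprn_gt0// leNgt => /negP; apply.
apply: (lt_le_trans mA); rewrite mulrC ler_wpM2l//; first exact: ltW.
apply: (le_trans (natr_le_expr2 m)); rewrite ler_weXn2l// ?ler1n//.
by rewrite /k -addnn -addnS leq_addr.
Qed.

(** The radius rho makes f and g Lipschitz with constant 1 / 30 on the square of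
    size rho, as [flow_defect_zero] requires; the smaller rho1 keeps the starting
    points in the domain of the embedding and within reach of the expansions. *)
Theorem phi_not_embeddable : ~ embeddable (@phi R).
Proof.
move=> [c [d [f [g [r [[c2 d2] r0 cf dg near_flow]]]]]].
have [Kf [qf [Kf1 qf1 cK]]] := psum_coef_bound r0 cf.
have [Kg [qg [Kg1 qg1 dK]]] := psum_coef_bound r0 dg.
pose K := Kf + Kg; pose q := qf + qg.
have K1 : 1 <= K by rewrite /K; lra.
have q1 : 1 <= q by rewrite /q; lra.
have cKq i j : `|c i j| <= K * q ^+ (i + j).
  apply: (le_trans (cK i j)); apply: ler_pM; rewrite ?exprn_ge0//; try by rewrite /K /q; lra.
  rewrite lerXn2r ?nnegrE /q//; lra.
have dKq i j : `|d i j| <= K * q ^+ (i + j).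
  apply: (le_trans (dK i j)); apply: ler_pM; rewrite ?exprn_ge0//; try by rewrite /K /q; lra.
  rewrite lerXn2r ?nnegrE /q//; lra.
clearbody K q; clear cK dK Kf Kg qf qg Kf1 Kg1 qf1 qg1.
have D0 : 0 < 50 * 60 * K * q ^+ 2.
  have [K0 q0] : 0 < K /\ 0 < q by split; lra.
  by rewrite !mulr_gt0// exprn_gt0.
(* The Lipschitz constants are at most 64 K q^2 rho; a factor above 64 * 30 in the
   denominator makes them at most 1 / 30. *)
pose rho := Num.min (r / 2) (50 * 60 * K * q ^+ 2)^-1.
have rho0 : 0 < rho by rewrite lt_min divr_gt0//= invr_gt0.
have rho_r : rho < r by apply: (@le_lt_trans _ _ (r / 2)); [rewrite ge_min lexx|lra].
have rho_b : rho * (50 * 60 * K * q ^+ 2) <= 1.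
  by rewrite -ler_pdivlMr// mul1r ge_min lexx orbT.
have Kq2 : 1 <= K * q ^+ 2 by rewrite expr2; nra.
have qKq : q <= K * q ^+ 2 by rewrite expr2; nra.
have rho_q : 50 * 60 * (rho * q) <= 1.
  by have := ler_wpM2l (ltW rho0) qKq; lra.
have rho_1 : rho * (50 * 60) <= 1 by have := ler_wpM2l (ltW rho0) Kq2; lra.
have rho8 : rho <= 8^-1 by lra.
have lip a h : is_psum a r h -> order_ge2 a -> (forall i j, `|a i j| <= K * q ^+ (i + j)) ->
    forall z w, `|z| <= rho -> `|w| <= rho -> `|h z - h w| <= 30^-1 * `|z - w|.
  move=> ah a2 aK z w zr wr.
  have q4 : 4 * q * rho <= 1 by lra.
  have := psum_lip ah K1 q1 aK a2 (ltW rho0) rho_r q4 zr wr.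
  rewrite -ler_pdivlMr// => /le_trans; apply; rewrite mulrAC ler_wpM2r//.
  rewrite ler_pdivrMr//.
  have -> : 4 * K * (4 * q * rho) ^+ 2 = (rho * (50 * 60 * K * q ^+ 2)) * (64 / 50 / 60 * rho) by field.
  have w0 : 0 <= 64 / 50 / 60 * rho by lra.
  by have := ler_wpM2r w0 rho_b; lra.
have at0 a h : is_psum a r h -> order_ge2 a -> h 0 = 0.
  move=> ah a2; have p0 : `|0 : R * R| < r by rewrite normr0.
  have [_ c0] := ah 0 p0.
  rewrite -(cvg_lim (@Rhausdorff R) c0); apply/cvg_lim => //.
  apply: cvg_near_cst; near=> n.
  rewrite big1 // => i _; rewrite big1 // => j _.
  case: i => [[|i] ?]; last by rewrite /= !expr0n /= mulr0 mul0r.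
  case: j => [[|j] ?]; last by rewrite /= !expr0n /= mulr0.
  by rewrite /= a2// !mul0r.
have f0 := at0 _ _ cf c2; have g0 := at0 _ _ dg d2.
have fl := lip _ _ cf c2 cKq; have gl := lip _ _ dg d2 dKq.
move: near_flow => /nbhs_ballP[del /= del0 hflow].
pose rho1 := Num.min (rho / 16) (del / 2).
have rho10 : 0 < rho1 by rewrite lt_min !divr_gt0.
have rho1_rho : rho1 <= rho / 16 by rewrite ge_min lexx.
have rho1_del : rho1 <= del / 2 by rewrite ge_min lexx orbT.
have zeros x0 eps : `|x0| < rho1 -> 0 < eps ->
    exists x y, [/\ `|x - x0| < eps, 0 < y, y < eps & defect f g x y = 0].
  move=> x0r e0.
  pose y0 := Num.min rho1 (eps / 10).
  have y00 : 0 < y0 by rewrite lt_min rho10 divr_gt0.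
  have y0r : y0 <= rho1 by rewrite ge_min lexx.
  have y0e : y0 <= eps / 10 by rewrite ge_min lexx orbT.
  have small u : rho1 < u -> `|(x0, y0)| < u.
    move=> ru; rewrite norm_pair_lt /= (gtr0_norm y00).
    by rewrite (lt_trans x0r ru) (le_lt_trans y0r ru).
  have pdel : ball (0 : R * R) del (x0, y0).
    rewrite -ball_normE /= sub0r normrN; apply: small; clear -rho1_del del0; lra.
  have [gamma [a [b [/andP[a0 b0] /andP[a1 b1] gm0 gm1 gmd]]]] := hflow _ pdel.
  have dgm s : 0 <= s <= 1 ->
      is_derive s 1 gamma ((gamma s).2 + f (gamma s), g (gamma s)).
    move=> /andP[s0 s1]; have [] := gmd s; last by [].
    by rewrite (lt_le_trans a0)// (le_lt_trans s1).
  have pr : `|(x0, y0)| < rho / 8 by apply: small; clear -rho1_rho rho0; lra.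
  have y16 : y0 <= 16^-1 by clear -y0r rho1_rho rho8; lra.
  have [x [y [h1 h2 h3 h4]]] := flow_defect_zero rho0 rho8 f0 g0 fl gl dgm gm0 gm1 pr y00 y16.
  exists x, y; split => //; [apply: (le_lt_trans h1)|apply: (le_lt_trans h3)];
    by clear -y0e e0; lra.
have q8 : 8 * q * rho1 <= 1.
  have : q * rho1 <= q * (rho / 16) by rewrite ler_wpM2l//; lra.
  lra.
have rho1_r : rho1 < r by lra.
have [ef Ef ef0] := psum_expansion cf K1 q1 cKq rho10 rho1_r q8.
have [eg Eg eg0] := psum_expansion dg K1 q1 dKq rho10 rho1_r q8.
have rho11 : rho1 <= 1 by lra.
have rho12 : rho1 <= 2^-1 by lra.
(* The expansion of defect, assembled from those of f, g, y and dbeta. *)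
have EX := expansionD (expansion_shift rho11 (expansion_cst1 rho1)) Ef.
have EyX := expansion_shift rho11 EX.
have E1g := expansionZ (lipb_add1 rho1) Eg.
have EN h e (H : expansion rho1 h e) := expansionZ (lipb_cst rho1 (-1)) H.
have ED := expansionD EyX (EN _ _ E1g).
have EP := EN _ _ (expansionM (dbeta_expansion rho12) ED).
have EA := expansionD (expansionZ (lipb_add1 rho1) E1g) EP.
have zeros' x0 eps : `|x0| < rho1 -> 0 < eps ->
    exists x y, [/\ `|x - x0| < eps, 0 < y, y < eps & (1 + x) * ((1 + x) * g (x, y)) +
      -1 * (dbeta (y / (1 + x)) * (y * (y * 1 + f (x, y)) + -1 * ((1 + x) * g (x, y)))) = 0].
  move=> x0r e0; have [x [y [h1 h2 h3 h4]]] := zeros x0 eps x0r e0.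
  by exists x, y; split => //; rewrite -h4 /defect; ring.
have Z := zeros_kill_expansion EA zeros'.
pose b j := j.+1%:R * lap_coef j.
pose delta j : R := (if j is j'.+1 then (if j' is j''.+1 then (j'' == 0)%:R else 0) + c 0%N j' else 0)
   - d 0%N j.
(* The vanishing of the n-th coefficient of the expansion at x = 0. *)
have dE n : d 0%N n = \sum_(i < n.+1) b i * delta (n - i)%N.
  have := Z n 0; rewrite normr0 => /(_ rho10).
  rewrite addr0 !mul1r eg0 mulN1r => /eqP; rewrite subr_eq0 => /eqP ->.
  apply: eq_bigr => i _; rewrite invr1 expr1n mulr1 -/(b i); congr (_ * _).
  rewrite /delta eg0 mulN1r; congr (_ - _); last by rewrite ?addr0 mul1r.
  by case: (n - i)%N => [//|j]; rewrite ef0.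
have d00 : d 0%N 0%N = 0 by exact: d2.
have d01 : d 0%N 1%N = 0 by exact: d2.
have c00 : c 0%N 0%N = 0 by exact: c2.
have c01 : c 0%N 1%N = 0 by exact: c2.
have delta0 : delta 0%N = 0 by rewrite /delta d00 subr0.
have delta1 : delta 1%N = 0 by rewrite /delta c00 d01 subr0 addr0.
have b0 : b 0%N = 0 by rewrite /b /lap_coef lap00 mul0r mulr0.
(* As b_0 = 0, the relation in degree 2 kills the y^2 term of g, so that delta
   starts with y^2 exactly. *)
have d02 : d 0%N 2%N = 0.
  by rewrite dE !big_ord_recl big_ord0 /= b0 mul0r delta1 subnn delta0 !mulr0 !addr0.
have delta2 : delta 2%N = 1 by rewrite /delta c01 d02 subr0 addr0.
have delta_le j : `|delta j| <= 3 * K * q ^+ j.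
  clear -K1 q1 cKq dKq delta.
  have qn1 n : 1 <= q ^+ n by exact: exprn_ege1.
  have d' := dKq 0%N j; have Kj : 1 <= K * q ^+ j.
    by have := qn1 j; clear -K1; nra.
  have h : `|if j is j'.+1 then (if j' is j''.+1 then (j'' == 0)%:R else 0) + c 0%N j' else 0|
      <= 2 * K * q ^+ j.
    case: j d' Kj => [_ Kj|j d' Kj]; first by rewrite normr0; clear -Kj; lra.
    apply: (le_trans (ler_normD _ _)).
    have h1 : `|if j is j''.+1 then (j'' == 0)%:R else 0 : R| <= 1.
      by case: j {d' Kj} => [|[|j]]; rewrite ?normr0 ?normr1.
    have h2 : `|c 0%N j| <= K * q ^+ j.+1.
      apply: (le_trans (cKq 0%N j)); rewrite ler_wpM2l//; first by clear -K1; lra.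
      by apply: ler_weXn2l.
    by move: h1 h2 Kj; clear; lra.
  apply: (le_trans (ler_normB _ _)); rewrite add0n in d'.
  by move: h d'; clear; lra.
have [A [Q [A0 Q1 hb]]] : exists A Q, [/\ 0 <= A, 1 <= Q & forall n, `|b n| <= A * Q ^+ n].
  have K3 : 1 <= 3 * K by clear -K1; lra.
  apply: (@quotient_coef_growth b delta (d 0%N) (3 * K) q) => // j.
  apply: (le_trans (dKq 0%N j)); rewrite add0n -[leRHS]mulrA ler_peMl ?ler1n//.
  have K0 : 0 <= K by clear -K1; lra.
  by rewrite mulr_ge0// exprn_ge0//; clear -q1; lra.
exact: lap_coef_not_geometric A0 Q1 hb.
Unshelve. all: by end_near. Qed.

End NotEmbeddable.

(** * Smooth functions built from the Laplace transform *)

Section Smooth.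
Context {R : realType}.
Implicit Types (p v : R * R).

(** A class of functions stable under both partial derivatives: [Ck_on] follows for
    all orders by induction on the order, with the expression generalized. *)
Inductive sexpr : Type :=
| SX | SY | SC (c : R) | SInv | SLap (k : nat)
| SAdd (e1 e2 : sexpr) | SMul (e1 e2 : sexpr).

Fixpoint seval (e : sexpr) (p : R * R) : R :=
  match e with
  | SX => p.1
  | SY => p.2
  | SC c => c
  | SInv => (1 + p.1)^-1
  | SLap k => lap k (slope p)
  | SAdd e1 e2 => seval e1 p + seval e2 p
  | SMul e1 e2 => seval e1 p * seval e2 p
  end.

(** The derivative in the direction (a, b). *)
Fixpoint sder (a b : R) (e : sexpr) : sexpr :=
  match e with
  | SX => SC a
  | SY => SC b
  | SC c => SC 0
  | SInv => SMul (SC (- a)) (SMul SInv SInv)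
  | SLap k => SMul (SLap k.+1)
      (SAdd (SMul (SC b) SInv) (SMul (SC (- a)) (SMul SY (SMul SInv SInv))))
  | SAdd e1 e2 => SAdd (sder a b e1) (sder a b e2)
  | SMul e1 e2 => SAdd (SMul (sder a b e1) e2) (SMul e1 (sder a b e2))
  end.

Lemma is_derive_curve (f : R * R -> R) p v (a : R) :
  is_derive (0 : R) 1 (fun h : R => f (h *: v + p)) a -> is_derive p v f a.
Proof.
move=> [d e].
have E : (fun h : R => h^-1 *: (((fun h : R => f (h *: v + p)) \o shift 0) (h *: 1) - f (0 *: v + p))) =
   (fun h : R => h^-1 *: ((f \o shift p) (h *: v) - f p)).
  apply/funext => h; congr (_ *: (f _ - f _)) => /=.
    by rewrite addr0 /GRing.scale /= mulr1.
  by rewrite scale0r add0r.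
split.
  by move: d; rewrite /derivable E.
by rewrite -e /derive E.
Qed.

Lemma is_derive_dir_comp (f : R * R -> R) (g : R -> R) p v (a b : R) :
  is_derive p v f a -> is_derive (f p) 1 g b -> is_derive p v (g \o f) (b * a).
Proof.
move=> [d e] dg; apply: is_derive_curve.
have E : (fun h : R => h^-1 *: (((fun h : R => f (h *: v + p)) \o shift 0) (h *: 1) - f (0 *: v + p))) =
   (fun h : R => h^-1 *: ((f \o shift p) (h *: v) - f p)).
  apply/funext => h; congr (_ *: (f _ - f _)) => /=.
    by rewrite addr0 /GRing.scale /= mulr1.
  by rewrite scale0r add0r.
have df : is_derive (0 : R) 1 (fun h : R => f (h *: v + p)) a.
  by split; [move: d; rewrite /derivable -E|rewrite -e /derive -E].
have dg' : is_derive (f (0 *: v + p)) 1 g b by rewrite scale0r add0r.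
exact: (@is_derive1_comp _ g (fun h : R => f (h *: v + p)) 0 _ _ dg' df).
Qed.

Lemma is_derive_inv (y : R) : y != 0 -> is_derive y 1 (fun y : R => y^-1) (- y ^- 2).
Proof.
move=> y0; apply: (is_derive_eq (@is_deriveV _ id y _ _ y0 (is_derive_id y 1))).
by rewrite /GRing.scale /= mulr1.
Qed.

Lemma is_derive_lin (p v : R * R) (a b : R) :
  is_derive p v (fun p => a * p.1 + b * p.2) (a * v.1 + b * v.2).
Proof.
apply: is_derive_curve.
have -> : (fun h : R => a * (h *: v + p).1 + b * (h *: v + p).2) =
    (fun h : R => (a * v.1 + b * v.2) *: h + (a * p.1 + b * p.2)).
  apply/funext => h.
  have -> : (h *: v + p).1 = h * v.1 + p.1 by [].
  have -> : (h *: v + p).2 = h * v.2 + p.2 by [].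
  by rewrite [X in _ = X + _]/GRing.scale /=; ring.
apply: (is_derive_eq (is_deriveD (is_deriveZ (a * v.1 + b * v.2) (is_derive_id (0 : R) 1))
  (is_derive_cst (a * p.1 + b * p.2) (0 : R) 1))).
by rewrite /GRing.scale /= mulr1 addr0.
Qed.

Lemma is_derive_seval e p (a b : R) : 1 + p.1 != 0 ->
  is_derive p (a, b) (seval e) (seval (sder a b e) p).
Proof.
move=> p0.
have dX : is_derive p (a, b) (fun p => p.1) a.
  have := is_derive_lin p (a, b) 1 0; rewrite /= !mul1r mul0r addr0.
  by under eq_fun do rewrite mul1r mul0r addr0.
have dY : is_derive p (a, b) (fun p => p.2) b.
  have := is_derive_lin p (a, b) 0 1; rewrite /= !mul1r mul0r add0r.
  by under eq_fun do rewrite mul1r mul0r add0r.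
have dI : is_derive p (a, b) (fun p => (1 + p.1)^-1) (- a * ((1 + p.1)^-1 * (1 + p.1)^-1)).
  have d1 : is_derive p (a, b) (fun p => 1 + p.1) a.
    by apply: (is_derive_eq (is_deriveD (is_derive_cst (1 : R) p (a, b)) dX)); rewrite add0r.
  have := @is_derive_dir_comp _ (fun y : R => y^-1) _ _ _ _ d1 (is_derive_inv p0).
  move=> h; apply: (is_derive_eq h).
  by rewrite -exprVn expr2; ring.
elim: e => [||c||k|e1 IH1 e2 IH2|e1 IH1 e2 IH2] //=.
- exact: is_derive_cst.
- have ds : is_derive p (a, b) (@slope R)
      (b * (1 + p.1)^-1 + - a * (p.2 * ((1 + p.1)^-1 * (1 + p.1)^-1))).
    apply: (is_derive_eq (is_deriveM dY dI)).
    by rewrite /GRing.scale /=; ring.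
  exact: (is_derive_dir_comp ds (is_derive_lap k (slope p))).
- exact: is_deriveD.
- apply: (is_derive_eq (is_deriveM IH1 IH2)).
  by rewrite /GRing.scale /=; ring.
Qed.

Lemma continuous_lap k : continuous (@lap R k).
Proof.
move=> t; apply/differentiable_continuous/derivable1_diffP.
by have [] := is_derive_lap k t.
Qed.

Lemma continuous_seval e p : 1 + p.1 != 0 -> {for p, continuous (seval e)}.
Proof.
move=> p0.
have cX : (fun q : R * R => q.1) @ p --> p.1 by apply: (@cvg_pair_fst _ _ _ _ id); exact: cvg_id.
have cY : (fun q : R * R => q.2) @ p --> p.2 by apply: (@cvg_pair_snd _ _ _ _ id); exact: cvg_id.
have cI : (fun q : R * R => (1 + q.1)^-1) @ p --> (1 + p.1)^-1.
  by apply: cvgV => //; apply: cvgD => //; exact: cvg_cst.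
elim: e => [||c||k|e1 IH1 e2 IH2|e1 IH1 e2 IH2] //=.
- exact: cvg_cst.
- apply: (@continuous_comp _ _ _ (@slope R) (lap k)); last exact: continuous_lap.
  exact: cvgM.
- exact: cvgD.
- exact: cvgM.
Qed.

Definition small_square : set (R * R) := [set p | `|p| < 8^-1].

Lemma open_small_square : open small_square.
Proof.
rewrite (_ : small_square = ball (0 : R * R) 8^-1); first exact: ball_open.
by apply/seteqP; split => p; rewrite /small_square /= -ball_normE /= sub0r normrN.
Qed.

Lemma Ck_seval k e (f : R * R -> R) : (forall p, small_square p -> f p = seval e p) -> Ck_on k small_square f.
Proof.
have U1 p : small_square p -> 1 + p.1 != 0 by move=> /small_denoms [p0 _ _]; exact: lt0r_neq0.
have nE e' f' p : (forall p, small_square p -> f' p = seval e' p) -> small_square p ->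
    \forall q \near p, seval e' q = f' q.
  move=> fe Up; have : nbhs p small_square by exact: open_nbhs_nbhs (conj open_small_square Up).
  by apply: filterS => q /fe.
have cE e' f' : (forall p, small_square p -> f' p = seval e' p) ->
    forall p, small_square p -> {for p, continuous f'}.
  move=> fe p Up.
  have c : seval e' @ p --> seval e' p := continuous_seval (e := e') (U1 p Up).
  have : f' @ p --> seval e' p.
    by apply: cvg_trans c; exact: near_eq_cvg (nE _ _ _ fe Up).
  by rewrite -(fe p Up).
elim: k e f => [|k IH] e f fe /=; first by split => //; exact: cE fe.
split; first exact: cE fe.
move=> v _; case: v => a b.
have df p : small_square p -> is_derive p (a, b) f (seval (sder a b e) p).
  move=> Up; apply: near_eq_is_derive (is_derive_seval e a b (U1 p Up)).
  exact: nE.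
split; first by move=> p /df [].
by apply: (IH (sder a b e)) => p Up; have dfp := df p Up; rewrite derive_val.
Qed.

Lemma smooth_seval e (f : R * R -> R) : (forall p, f p = seval e p) -> smooth_near0 f.
Proof.
move=> fe; exists small_square; split; first exact: open_small_square.
  by rewrite /small_square /= normr0 invr_gt0.
by move=> k; apply: (@Ck_seval k e).
Qed.

End Smooth.

(** * Linearization, analyticity and the theorem *)

Section Conjugacy.
Context {R : realType}.
Implicit Types (t c : R) (p q : R * R) (h : R -> R).

(** Both 1 + x and y are multiplied by 1 + h(t) / (1 + x), which is why the slope
    is unchanged. *)
Definition slide h p : R * R := (p.1 + h (slope p), p.2 + slope p * h (slope p)).

Lemma slope_slide h p : 1 + p.1 != 0 -> 1 + p.1 + h (slope p) != 0 ->
  slope (slide h p) = slope p.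
Proof.
move=> p0; set t := slope p => h0.
have yE : p.2 = t * (1 + p.1) by rewrite /t /slope divfK.
rewrite {1}/slope /slide -/t /= yE; move: (h t) h0 => k h0.
by field; rewrite -?addrA ?h0 ?addrA ?h0.
Qed.

Lemma slideK h p : 1 + p.1 != 0 -> 1 + p.1 + h (slope p) != 0 ->
  slide (fun t => - h t) (slide h p) = p.
Proof.
move=> p0 h0; rewrite {1}/slide slope_slide// /slide /=.
by rewrite mulrN !addrK -surjective_pairing.
Qed.

(** The same slide conjugates the inverse shear (x, y) |-> (x - y, y) to this map;
    the partial fractions in the slope now have the opposite values of c. *)
Definition phi_inv p : R * R :=
  (p.1 - p.2 - 2 * (yfrac (- 2^-1) p - yfrac 0 p),
   p.2 - (2 * yfrac 0 p - 4 * yfrac (- 2^-1) p + 2 * yfrac (-1) p)).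

End Conjugacy.

Section Main.
Context {R : realType}.
Implicit Types (t c : R) (p q : R * R) (h : R -> R).

Lemma near_small (f : R * R -> R * R) (e : R) : 0 < e -> f 0 = 0 ->
  {for 0, continuous f} -> \forall p \near (0 : R * R), `|f p| < e.
Proof.
move=> e0 f0 /cvgrPdist_lt /(_ e e0); rewrite f0; apply: filterS => p.
by rewrite sub0r normrN.
Qed.

Lemma slope0 : slope (0 : R * R) = 0.
Proof. by rewrite /slope /= mul0r. Qed.

Lemma continuous_pair_at0 (u v : R * R -> R) :
  {for 0, continuous u} -> {for 0, continuous v} ->
  {for 0, continuous (fun p => (u p, v p))}.
Proof.
move=> /cvgrPdist_lt cu /cvgrPdist_lt cv; apply/cvgrPdist_lt => e e0; near=> p.
rewrite norm_pair_lt; apply/andP; split; near: p; [exact: cu|exact: cv].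
Unshelve. all: by end_near. Qed.

Let e1 (s : R) : @sexpr R := SAdd (SX) (SMul (SC s) (SLap 0)).
Let e2 (s : R) : @sexpr R := SAdd SY (SMul (SC s) (SMul (SMul SY SInv) (SLap 0))).

(** The linearization is s = 1, its inverse s = -1. *)
Definition linearize (s : R) : R * R -> R * R := slide (fun t => s * lap 0 t).

Lemma linearizeE s p : linearize s p = (seval (e1 s) p, seval (e2 s) p).
Proof. by rewrite /linearize /slide /e1 /e2 /=; congr (_, _ + _); rewrite [LHS]mulrCA. Qed.

Lemma linearize0 s : linearize s (0 : R * R) = 0.
Proof. by rewrite /linearize /slide slope0 lap00 mulr0 mul0r !addr0. Qed.

Lemma continuous_linearize s : {for 0, continuous (linearize s)}.
Proof.
have n0 : 1 + (0 : R * R).1 != 0 by rewrite addr0 oner_neq0.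
rewrite (_ : linearize s = fun p => (seval (e1 s) p, seval (e2 s) p)); last exact/funext/linearizeE.
by apply: continuous_pair_at0; exact: continuous_seval.
Qed.

Lemma smooth_linearize s : componentwise smooth_near0 (linearize s).
Proof.
split; [apply: (@smooth_seval _ (e1 s))|apply: (@smooth_seval _ (e2 s))] => p;
  by rewrite linearizeE.
Qed.

Lemma near_norm_lt (e : R) : 0 < e -> \forall p \near (0 : R * R), `|p| < e.
Proof.
move=> e0; apply/nbhs_ballP; exists e => // p.
by rewrite -ball_normE /= sub0r normrN.
Qed.

Lemma near_linearize_denoms s : \forall p \near (0 : R * R),
  [/\ `|p| < 8^-1, `|linearize s p| < 8^-1, 1 + p.1 != 0 & 1 + p.1 + s * lap 0 (slope p) != 0].
Proof.
have e0 : 0 < 8^-1 :> R by rewrite invr_gt0.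
near=> p.
have p8 : `|p| < 8^-1 by near: p; exact: near_norm_lt.
have l8 : `|linearize s p| < 8^-1.
  by near: p; apply: near_small => //; [exact: linearize0|exact: continuous_linearize].
split => //; first by have [/lt0r_neq0] := small_denoms p8.
have [h _ _] := small_denoms l8; move: h => /lt0r_neq0.
by rewrite /linearize /slide /= addrA.
Unshelve. all: by end_near. Qed.

Lemma linearize_opp s : (fun t => - (s * lap 0 t)) = (fun t => - s * lap 0 t) :> (R -> R).
Proof. by apply/funext => t; rewrite mulNr. Qed.

Lemma linearizeK s : \forall p \near (0 : R * R), linearize (- s) (linearize s p) = p.
Proof.
have := near_linearize_denoms s; apply: filterS => p [_ _ p0 h0].
by rewrite /linearize -linearize_opp slideK.
Qed.

Lemma linearize_local_diffeo : local_diffeo smooth_near0 (linearize 1) (linearize (-1)).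
Proof.
split; [exact: linearize0|exact: smooth_linearize|exact: smooth_linearize|split].
  exact: linearizeK.
by have := linearizeK (-1); rewrite opprK.
Qed.

(** At the point [linearize (-1) p] the slope is that of p, so that the functional
    equation at this slope is exactly what is left to check. *)
Lemma linearize_conj : \forall p \near (0 : R * R), linearize 1 (phi (linearize (-1) p)) = shear p.
Proof.
have ok := near_linearize_denoms (-1); have K := linearizeK (-1); rewrite opprK in K.
near=> p.
have [p8 l8 p0 h0] : [/\ `|p| < 8^-1, `|linearize (-1) p| < 8^-1, 1 + p.1 != 0 &
   1 + p.1 + -1 * lap 0 (slope p) != 0] by near: p; exact: ok.
have Kp : linearize 1 (linearize (-1) p) = p by near: p; exact: K.
have sE : slope (linearize (-1) p) = slope p by rewrite /linearize slope_slide.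
have [sphi t0 _] := slope_phi l8.
rewrite sE in sphi t0.
have [_ t7 _] := small_denoms p8.
have t1 : `|slope p| < 1 by apply: (lt_trans t7); rewrite invf_lt1// ltr1n.
have F := lap_functional_eq t1.
rewrite /linearize /slide sphi (phiE l8) sE /=.
rewrite /shear.
have yE : p.2 = slope p * (1 + p.1) by rewrite /slope divfK.
have -> : lap 0 (slope p / (1 + slope p)) = (1 + slope p) * lap 0 (slope p) - shift_amount (slope p).
  by rewrite /shift_amount -F opprB [RHS]addrC subrK.
move: (lap 0 _) (shift_amount _) => L A.
congr (_, _); first ring.
field; exact: lt0r_neq0.
Unshelve. all: by end_near. Qed.

Lemma phi_smoothly_linearizable : smoothly_linearizable (@phi R).
Proof.
exists (linearize 1), (linearize (-1)); split; [exact: linearize_local_diffeo|exact: linearize_conj].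
Qed.

End Main.

Section Analytic.
Context {R : realType}.
Implicit Types (t c : R) (p q : R * R).

Lemma geo_ext (a : nat -> nat -> R) (f f' : R * R -> R) :
  (forall p, f p = f' p) -> geo_series a f -> geo_series a f'.
Proof. by move=> /funext ->. Qed.

(** The coefficients of u1 x + u2 y plus a combination of the fractions
    y / (1 + x + c y) for c = 0, c1 and c2. *)
Definition mixed_coef (u1 u2 w0 w1 w2 c1 c2 : R) i j : R :=
  lin_coef u1 u2 i j + (w0 * ygeo_coef 0 i j + (w1 * ygeo_coef c1 i j + w2 * ygeo_coef c2 i j)).

Lemma geo_series_mixed u1 u2 w0 w1 w2 c1 c2 : `|c1| <= 1 -> `|c2| <= 1 ->
  geo_series (mixed_coef u1 u2 w0 w1 w2 c1 c2)
   (fun p => u1 * p.1 + u2 * p.2 +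
     (w0 * yfrac 0 p + (w1 * yfrac c1 p + w2 * yfrac c2 p))).
Proof.
move=> h1 h2; apply: geo_seriesD; first exact: geo_series_lin.
have h0 : `|0 : R| <= 1 by rewrite normr0.
by do 2 (apply: geo_seriesD; first exact/geo_seriesZ/geo_series_ygeo);
  exact/geo_seriesZ/geo_series_ygeo.
Qed.

Lemma geo_analytic a (f : R * R -> R) : geo_series a f -> analytic_near0 f.
Proof.
by move=> /geo_series_psum h; exists a, 8^-1; split; rewrite ?invr_gt0.
Qed.

Let n1 : `|1 : R| <= 1. Proof. by rewrite normr1. Qed.
Let n2 : `|2^-1 : R| <= 1. Proof. by rewrite ger0_norm ?invr_ge0// invf_le1// ler1n. Qed.
Let nN1 : `|-1 : R| <= 1. Proof. by rewrite normrN. Qed.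
Let nN2 : `|- 2^-1 : R| <= 1. Proof. by rewrite normrN. Qed.

Lemma phi_analytic : componentwise analytic_near0 (@phi R).
Proof.
split; [apply: (geo_analytic (a := mixed_coef 1 1 2 (-2) 0 2^-1 1))
       |apply: (geo_analytic (a := mixed_coef 0 1 2 (-4) 2 2^-1 1))];
  apply: geo_ext (geo_series_mixed _ _ _ _ _ n2 n1) => p; rewrite /phi /=; ring.
Qed.

Lemma phi_inv_analytic : componentwise analytic_near0 (@phi_inv R).
Proof.
split; [apply: (geo_analytic (a := mixed_coef 1 (-1) 2 (-2) 0 (- 2^-1) (-1)))
       |apply: (geo_analytic (a := mixed_coef 0 1 (-2) 4 (-2) (- 2^-1) (-1)))];
  apply: geo_ext (geo_series_mixed _ _ _ _ _ nN2 nN1) => p; rewrite /phi_inv /=; ring.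
Qed.

Lemma geo_O2 a (f : R * R -> R) : geo_series a f -> order_ge2 a -> analytic_O2 f.
Proof.
by move=> /geo_series_psum h a2; exists a, 8^-1; split; rewrite ?invr_gt0.
Qed.

(** The three fractions all start with y, so the linear part is w0 + w1 + w2
    times y. *)
Lemma mixed_O2 w0 w1 w2 c1 c2 : w0 + w1 + w2 = 0 ->
  order_ge2 (mixed_coef 0 0 w0 w1 w2 c1 c2).
Proof.
move=> w i j; rewrite /mixed_coef /lin_coef.
case: i => [|[|i]]; case: j => [|[|j]] //= _; rewrite ?bin0 ?expr0; try ring.
by rewrite -[RHS]w; ring.
Qed.

Lemma phi_tangent : tangent_to_shear (@phi R).
Proof.
split; [apply: (geo_O2 (a := mixed_coef 0 0 2 (-2) 0 2^-1 1))
       |apply: (geo_O2 (a := mixed_coef 0 0 2 (-4) 2 2^-1 1))]; 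
  try (by apply: mixed_O2; ring);
  apply: geo_ext (geo_series_mixed _ _ _ _ _ n2 n1) => p; rewrite /phi /shear /=; ring.
Qed.

Lemma phi_inv_slopeE p : 0 < 1 + p.1 -> `|slope p| < 2^-1 -> let t := slope p in
  phi_inv p = (p.1 - p.2 - t ^+ 2 / (1 - t / 2),
               p.2 - t ^+ 3 / ((1 - t) * (1 - t / 2))).
Proof.
move=> x0 t2 /=; move: t2; rewrite /phi_inv /yfrac mul0r addr0.
have n0 : 1 + p.1 != 0 by exact: lt0r_neq0.
have yE : p.2 = slope p * (1 + p.1) by rewrite /slope divfK.
rewrite ltr_norml yE; move: (slope p) n0 x0 => t n0 x0 /andP[t1 t2].
have -> : 1 + p.1 + - 2^-1 * (t * (1 + p.1)) = (1 + p.1) * (1 - t / 2) by field.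
have -> : 1 + p.1 + -1 * (t * (1 + p.1)) = (1 + p.1) * (1 - t) by ring.
congr (_, _); congr (_ - _); field; repeat (apply/andP; split => //);
  by apply: lt0r_neq0; lra.
Qed.

Lemma phiK p : `|p| < 8^-1 -> phi_inv (phi p) = p.
Proof.
move=> p8; have [x0 t7 _] := small_denoms p8.
have [sE tp xp] := slope_phi p8.
move: t7; rewrite ltr_norml => /andP[t1 t2].
have s2 : `|slope (phi p)| < 2^-1.
  rewrite sE normrM normfV (gtr0_norm tp) ltr_pdivrMr// ltr_norml; apply/andP; split; lra.
rewrite (phi_inv_slopeE xp s2) sE (phiE p8) /shift_amount /=.
have yE : p.2 = slope p * (1 + p.1) by rewrite /slope divfK// lt0r_neq0.
rewrite [RHS]surjective_pairing yE; move: (slope p) tp t1 t2 {sE yE s2} => t tp t1 t2.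
congr (_, _); field; repeat (apply/andP; split => //);
  by apply: lt0r_neq0; lra.
Qed.

Lemma phi_invK p : `|p| < 8^-1 -> phi (phi_inv p) = p.
Proof.
move=> p8; have [x0 t7 _] := small_denoms p8.
have x7 : 7 / 8 < 1 + p.1.
  have := le_lt_trans (norm_fst_le p) p8; rewrite ltr_norml => /andP[? _]; lra.
have s2 : `|slope p| < 2^-1.
  by apply: (lt_trans t7); rewrite ltf_pV2 ?posrE// ltr_nat.
have yE : p.2 = slope p * (1 + p.1) by rewrite /slope divfK// lt0r_neq0.
have E := phi_inv_slopeE x0 s2.
move: t7; rewrite ltr_norml => /andP[t1 t2].
set t := slope p in s2 yE E t1 t2.
have tm : 0 < 1 - t by lra.
have th : 0 < 1 - t / 2 by lra.
pose B := t ^+ 2 / (1 - t / 2).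
have B2 : B < 2^-1.
  by rewrite ltr_pdivrMr//; nra.
have D0 : 0 < (1 + p.1) * (1 - t) - B by nra.
have q1 : 1 + (phi_inv p).1 = (1 + p.1) * (1 - t) - B.
  by rewrite E /= yE /B; ring.
have q2 : (phi_inv p).2 = t / (1 - t) * ((1 + p.1) * (1 - t) - B).
  by rewrite E /= yE /B; field; rewrite !lt0r_neq0//; lra.
have qs : slope (phi_inv p) = t / (1 - t).
  by rewrite /slope q1 q2 mulfK// lt0r_neq0.
have q0 : 0 < 1 + (phi_inv p).1 by rewrite q1.
have qs2 : `|slope (phi_inv p)| < 2^-1.
  rewrite qs normrM normfV (gtr0_norm tm) ltr_pdivrMr// ltr_norml; apply/andP; split; lra.
rewrite (phi_slopeE q0 qs2) qs /shift_amount E /=.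
rewrite [RHS]surjective_pairing yE.
congr (_, _); field; repeat (apply/andP; split => //);
  by apply: lt0r_neq0; lra.
Qed.

Lemma phi_analytic_transformation : analytic_transformation (@phi R).
Proof.
exists (@phi_inv R); split.
- by rewrite /phi /yfrac /= !mul0r !subrr !mulr0 !addr0 subrr addr0.
- exact: phi_analytic.
- exact: phi_inv_analytic.
- have e0 : 0 < 8^-1 :> R by rewrite invr_gt0.
  by split; have := near_norm_lt e0; apply: filterS => p; [exact: phiK|exact: phi_invK].
Qed.

End Analytic.

Theorem corollary1p3 (R : realType) :
  exists phi : R * R -> R * R,
    [/\ analytic_transformation phi, tangent_to_shear phi,
        smoothly_linearizable phi & ~ embeddable phi].
Proof.
exists (@phi R); split.
- exact: phi_analytic_transformation.
- exact: phi_tangent.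
- exact: phi_smoothly_linearizable.
- exact: phi_not_embeddable.
Qed.
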